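(* Let $N\ge2$ be an integer, let $T$ be an interval exchange transformation on $[0,1[$, let $0<\zeta_1<1$ and $a_1,a_2\in\mathbb{Z}$, and let $T_f(x,s)=(Tx,s+f(x))$ on $[0,1[\times\mathbb{Z}/N\mathbb{Z}$, where $f=a_1$ on $[0,\zeta_1[$ and $f=a_2$ on $[\zeta_1,1[$. Assume that $T$ is linearly recurrent and that $T_f$ is minimal. Then $T_f$ is uniquely ergodic.
   Context: Interval exchange: given $\lambda_1,\dots,\lambda_r>0$ with sum $1$ and a permutation $\pi$ of $\{1,\dots,r\}$, put $I_i=[\sum_{j<i}\lambda_j,\sum_{j\le i}\lambda_j[$ (semi-open) and $Tx=x+\sum_{\pi^{-1}(j)<\pi^{-1}(i)}\lambda_j-\sum_{j<i}\lambda_j$ for $x\in I_i$. Linear recurrence: the trajectory of $x$ is $(x_n)_{n\ge0}$ with $x_n=i$ if $T^nx\in I_i$; $L(T)$ is the set of all finite factors of all trajectories. $T$ is linearly recurrent if there is a constant $K$ such that each word of length $n$ of $L(T)$ occurs in every word of length at least $Kn$ of $L(T)$. The values $a_i$ of $f$ are reduced modulo $N$. Minimal: every orbit is dense ($[0,1[\times\{s\}$ has the usual interval topology). Uniquely ergodic: there exists a unique invariant probability measure. *)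

(* Defs.v *)
From HB Require Import structures.
From mathcomp Require Export all_boot all_order all_algebra perm.
From mathcomp Require Export all_classical all_reals all_analysis.

Set Implicit Arguments.
Unset Strict Implicit.
Unset Printing Implicit Defensive.

Import Order.TTheory GRing.Theory Num.Theory.
Import numFieldNormedType.Exports.

Local Open Scope classical_set_scope.
Local Open Scope ring_scope.

HB.instance Definition _ (n : nat) := isPointed.Build 'I_n.+1 ord0.
HB.instance Definition _ (n : nat) := @isMeasurable.Build default_measure_display
  'I_n.+1 discrete_measurable discrete_measurable0
  discrete_measurableC discrete_measurableU.

Section interval_exchange.
Variables (R : realType) (r : nat) (lam : 'I_r -> R) (pi : 'S_r).

Definition iet_interval (i : 'I_r) : set R :=
  `[\sum_(j < r | (j < i)%N) lam j, \sum_(j < r | (j <= i)%N) lam j[.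

(* The intervals partition [0, 1[ when the lengths are positive with sum 1;
   outside of them the map is the identity, a value that is never used. *)
Definition iet (x : R) : R :=
  if [pick i : 'I_r | x \in iet_interval i] is Some i then
    x + \sum_(j < r | ((pi^-1)%g j < (pi^-1)%g i)%N) lam j
      - \sum_(j < r | (j < i)%N) lam j
  else x.

Definition is_trajectory (x : R) (u : nat -> 'I_r) : Prop :=
  forall n, iet_interval (u n) (iter n iet x).

Definition language : set (seq 'I_r) :=
  [set w | exists x u, [/\ `[0, 1[%classic x, is_trajectory x u &
     exists k, w = mkseq (fun n => u (k + n)%N) (size w)]].

Definition linearly_recurrent : Prop :=
  exists K : R, forall v w : seq 'I_r, language v -> language w ->
    K * (size v)%:R <= (size w)%:R -> infix v w.

End interval_exchange.

Section skew_product.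
Variables (R : realType) (N : nat).

Definition phase_space : set (R * 'Z_N) := `[0, 1[ `*` [set: 'Z_N].

Definition two_step (zeta1 : R) (a1 a2 : int) (x : R) : 'Z_N :=
  if x < zeta1 then a1%:~R else a2%:~R.

Definition skew (T : R -> R) (f : R -> 'Z_N) (p : R * 'Z_N) : R * 'Z_N :=
  (T p.1, p.2 + f p.1).

Variable S : R * 'Z_N -> R * 'Z_N.

(* Full two-sided orbit of a map that is a bijection of the phase space. *)
Definition orbit_of (p : R * 'Z_N) : set (R * 'Z_N) :=
  [set q | phase_space q /\ exists n, iter n S p = q \/ iter n S q = p].

(* 'Z_N is discrete, so density is density in each [0, 1[ x {s}. *)
Definition minimal : Prop := forall p, phase_space p -> forall s : 'Z_N,
  `[0, 1[ `<=` closure [set x | orbit_of p (x, s)].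

(* A Borel probability on the phase space is encoded as a Borel probability
   on R x 'Z_N giving it full mass. *)
Definition invariant_probability (mu : probability (R * 'Z_N)%type R) : Prop :=
  mu phase_space = 1%E /\
  forall A, measurable A -> mu (phase_space `&` S @^-1` A) = mu A.

(* Uniqueness is equality on measurable sets: values elsewhere are junk. *)
Definition uniquely_ergodic : Prop :=
  (exists mu, invariant_probability mu) /\
  (forall mu nu, invariant_probability mu -> invariant_probability nu ->
     forall A, measurable A -> mu A = nu A).

End skew_product.

(* Main.v *)
From HB Require Import structures.
Require Import Defs.
From mathcomp Require Import measurable_realfun ring lra zify.

Set Implicit Arguments.
Unset Strict Implicit.
Unset Printing Implicit Defensive.

Import Order.TTheory GRing.Theory Num.Theory.
Import numFieldNormedType.Exports.

Local Open Scope classical_set_scope.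
Local Open Scope ring_scope.

(** Linear recurrence of [T] gives a constant [c] such that the cylinders of
    order [n] are longer than [c / n] ([recurrent_cyl_long]: every orbit visits
    every cylinder within a time proportional to [n]) and [T ^ m] moves every
    point by at least a constant over [m] ([return_far]: otherwise some code
    would be periodic for so long that all codes would be periodic, and [T]
    could not be minimal).

    The map [T_f] is a piecewise translation over the partition obtained by
    cutting the intervals of [T] at [zeta1]. The refined cylinders can be much
    shorter than a constant over [n], but only for those [n] for which [zeta1]
    is very close to an end of its two-sided cylinder of order [n]. Since such
    ends are well spaced, the distance to the end stops being small, relative
    to the length scale [1 / n], at some later [n]. Hence for infinitely many
    good times [n] the refined cylinders of order [n] are longer than a
    constant over [n] ([good_times]). This is the criterion of Boshernitzan.

    An interval of length about [1 / n] inside such a cylinder has about [n]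
    successive images by [T_f] that are disjoint translates. An invariant
    probability gives them equal masses, at most [1 / n], so it is absolutely
    continuous with respect to Lebesgue measure ([null_mass]).

    Lebesgue measure is ergodic ([phase_measure_ergodic]). Let [A] be an
    invariant set. All images of such an interval contain the same proportion
    of [A], and together they fill a fixed proportion of the phase space, so by
    regularity of the measure this proportion is close to 0 or to 1 for large
    [n] ([flat_dichotomy]). Along an orbit the alternative does not change from
    a point to the next, because the image of the interval around a point and
    the interval around its image lie in one longer interval of the same kind
    ([misses_step]). By minimality a single orbit visits all the intervals, so
    the alternative is the same everywhere and [A] is almost null or almost
    full, for every tolerance.

    Two invariant probabilities that differ would, through a Hahn decomposition
    of their difference, give an invariant set which is neither null nor of full
    measure ([invariant_eq]). Existence is provided by Lebesgue measure
    itself. *)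


(** * Cylinders of a piecewise translation *)

Definition unit01 (R : realType) (x : R) : bool := 0 <= x < 1.

(** [lft x] and [rgt x] are the ends of the cell of [x]. Both the exchanged
    intervals and their common refinement with the jump of [f] are partitions
    of this kind. *)
Record cellwise_translation (R : realType) (T lft rgt : R -> R) : Prop :=
  CellwiseTranslation {
  cell_mem : forall x, unit01 x -> lft x <= x < rgt x;
  cell_sub : forall x, unit01 x -> 0 <= lft x /\ rgt x <= 1;
  cell_map : forall x, unit01 x -> unit01 (T x);
  cell_trans : forall x y, unit01 x -> lft x <= y < rgt x ->
    [/\ T y = T x + (y - x), lft y = lft x & rgt y = rgt x] }.

Section cylinders.
Variables (R : realType) (T lft rgt : R -> R).
Hypothesis HT : cellwise_translation T lft rgt.

(** Ends of the cylinder of order [n] of [x]: the points with the same cells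
    as [x] up to time [n - 1]. *)
Fixpoint lo n x : R :=
  if n is m.+1 then Num.max (lft x) (lo m (T x) - (T x - x)) else 0.
Fixpoint hi n x : R :=
  if n is m.+1 then Num.min (rgt x) (hi m (T x) - (T x - x)) else 1.

Definition same_code n x y :=
  forall i, (i < n)%N -> lft (iter i T x) = lft (iter i T y).

Lemma iter_unit01 n x : unit01 x -> unit01 (iter n T x).
Proof. by move=> hx; elim: n => //= n; exact: (cell_map HT). Qed.

Lemma cyl_mem n x : unit01 x -> lo n x <= x < hi n x.
Proof.
elim: n x => [|n IH] x hx /=; first exact: hx.
have /andP[h1 h2] := IH _ (cell_map HT hx); have /andP[h3 h4] := cell_mem HT hx.
rewrite ge_max lt_min h3 h4 /=; lra.
Qed.

Lemma cyl_sub n x : unit01 x -> 0 <= lo n x /\ hi n x <= 1.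
Proof.
case: n => [|n] hx /=; first by [].
by have [h1 h2] := cell_sub HT hx; rewrite le_max h1 ge_min h2.
Qed.

Lemma cyl_unit01 n x y : unit01 x -> lo n x <= y < hi n x -> unit01 y.
Proof. by move=> /(@cyl_sub n) [h1 h2] /andP[h3 h4]; apply/andP; split; lra. Qed.

Lemma cyl_eq n x y : unit01 x -> lo n x <= y < hi n x ->
  lo n y = lo n x /\ hi n y = hi n x.
Proof.
elim: n x y => [|n IH] x y hx //= /andP[]; rewrite ge_max lt_min.
move=> /andP[h1 h2] /andP[h3 h4].
have [e1 -> ->] := cell_trans HT hx (introT andP (conj h1 h3)).
have [|-> ->] := IH (T x) (T y) (cell_map HT hx); first by rewrite e1; lra.
by split; congr (Num.Def.maxr _ _) || congr (Num.Def.minr _ _); rewrite e1; ring.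
Qed.

Lemma cyl_iter n x y i : unit01 x -> lo n x <= y < hi n x -> (i <= n)%N ->
  iter i T y = iter i T x + (y - x).
Proof.
elim: n x y i => [|n IH] x y [|i] hx //=; try by move=> *; ring.
move=> /andP[]; rewrite ge_max lt_min => /andP[h1 h2] /andP[h3 h4] hi.
have [e1 _ _] := cell_trans HT hx (introT andP (conj h1 h3)).
rewrite -!iterS !iterSr (IH (T x) (T y)) ?e1 //; first by ring.
  exact: (cell_map HT).
lra.
Qed.

Lemma cyl_same_code n x y : unit01 x -> lo n x <= y < hi n x ->
  same_code n x y.
Proof.
elim: n x y => [|n IH] x y hx //= /andP[]; rewrite ge_max lt_min.
move=> /andP[h1 h2] /andP[h3 h4].
have [e1 e2 _] := cell_trans HT hx (introT andP (conj h1 h3)).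
case=> [|i] hi /=; first by rewrite e2.
rewrite -!iterS !iterSr; apply: IH => //; first exact: (cell_map HT).
rewrite e1; lra.
Qed.

Lemma lft_eq_mem x y : unit01 x -> unit01 y -> lft x = lft y ->
  lft x <= y < rgt x.
Proof.
move=> hx hy e; have /andP[h1 h2] := cell_mem HT hx.
have /andP[h3 h4] := cell_mem HT hy.
have [xy|xy] := leP x y; last by apply/andP; split; lra.
have [|_ _ ->] := cell_trans HT hy (y := x); lra.
Qed.

Lemma same_code_cyl n x y : unit01 x -> unit01 y -> same_code n x y ->
  lo n x <= y < hi n x.
Proof.
elim: n x y => [|n IH] x y hx hy hs //=.
have /andP[h1 h2] := lft_eq_mem hx hy (hs 0%N isT).
have [e1 _ _] := cell_trans HT hx (introT andP (conj h1 h2)).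
have hT : same_code n (T x) (T y).
  by move=> i hi; have := hs i.+1 hi; rewrite !iterSr.
have /andP[] := IH _ _ (cell_map HT hx) (cell_map HT hy) hT.
rewrite e1 ge_max lt_min h1 h2 /= => h3 h4; lra.
Qed.

(** A code of length [M] determines the part of it that starts at time [m]. *)
Lemma cyl_image n m M x z : unit01 x -> (n + m <= M)%N ->
  lo M x <= z < hi M x ->
  lo n (iter m T x) <= z + (iter m T x - x) < hi n (iter m T x).
Proof.
move=> hx nmM hz.
have -> : z + (iter m T x - x) = iter m T z.
  by rewrite (cyl_iter hx hz) //; [ring | lia].
apply: same_code_cyl; try exact: iter_unit01; first exact/iter_unit01/cyl_unit01/hz.
move=> i hi; rewrite -!iterD; apply: (cyl_same_code hx hz); lia.
Qed.

Lemma cyl_image_ends n m M x : unit01 x -> (n + m <= M)%N ->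
  let q := iter m T x in
  lo n q - q <= lo M x - x /\ hi M x - x <= hi n q - q.
Proof.
move=> hx nmM q; have /andP[h1 h2] := cyl_mem M hx.
have /andP[h5 h6] : lo n q <= q < hi n q by exact/cyl_mem/iter_unit01.
split.
  have /andP[h3 h4] := cyl_image hx nmM (introT andP (conj (lexx (lo M x)) (le_lt_trans h1 h2))).
  rewrite -/q in h3; lra.
rewrite leNgt; apply/negP => h.
have : lo n q <= hi n q - q + x + (q - x) < hi n q.
  by apply: (@cyl_image n m M x) => //; apply/andP; split; lra.
lra.
Qed.

Section gaps.
Variables (M : nat) (d : R).
Hypothesis T_onto : forall y, unit01 y -> exists2 x, unit01 x & T x = y.
Hypothesis T_inj : forall x y, unit01 x -> unit01 y -> T x = T y -> x = y.
Hypothesis dM : forall x, unit01 x -> d <= hi M x - lo M x.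

Lemma iter_inj m x y : unit01 x -> unit01 y -> iter m T x = iter m T y -> x = y.
Proof.
move=> hx hy; elim: m => //= m IH e; apply: IH.
by apply: T_inj => //; exact: iter_unit01.
Qed.

Lemma iter_onto m y : unit01 y -> exists2 x, unit01 x & iter m T x = y.
Proof.
elim: m y => [|m IH] y hy; first by exists y.
have [x hx <-] := T_onto hy; have [z hz <-] := IH _ hx.
by exists z => //; rewrite iterS.
Qed.

(** When the image of a long cylinder of order [M] sits inside a shorter
    cylinder, what is left on either side contains images of further
    cylinders of order [M], so it is empty or at least as long as they are. *)
Lemma cyl_gap_left n m x : unit01 x -> (n + m <= M)%N ->
  let q := iter m T x in
  lo n q - q < lo M x - x -> d <= (lo M x - x) - (lo n q - q).
Proof.
move=> hx nmM q h; have mM : (m <= M)%N by lia.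
have hq : unit01 q by exact: iter_unit01.
have /andP[h5 h6] := cyl_mem n hq; have /andP[h7 h8] := cyl_mem M hx.
have hz : unit01 (lo n q) by apply: (cyl_unit01 hq (n := n)); apply/andP; split; lra.
have [z uz ez] := iter_onto m hz.
have [e1 e2] : lo n (lo n q) = lo n q /\ hi n (lo n q) = hi n q.
  by apply: cyl_eq => //; apply/andP; split; lra.
have := cyl_image_ends uz nmM; rewrite /= ez e1 e2 => -[h1 h2].
have /andP[h9 h10] := cyl_mem M uz.
have := dM uz.
suff : hi M z - z + lo n q <= lo M x - x + q by lra.
rewrite leNgt; apply/negP => hc.
(* otherwise the cylinder of [z] contains the left end of the cylinder of [x] *)
pose w := lo M x - x + q - lo n q + z.
have hw : lo M z <= w < hi M z by apply/andP; split; rewrite /w; lra.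
have hl : lo M x <= lo M x < hi M x by apply/andP; split; lra.
have ew : w = lo M x.
  apply: (@iter_inj m); [exact: cyl_unit01 hw | exact: cyl_unit01 hl |].
  by rewrite (cyl_iter uz hw mM) (cyl_iter hx hl mM) ez -/q /w; ring.
have [e3 _] := cyl_eq uz hw; have [e4 _] := cyl_eq hx hl.
have : lo M z = lo M x by rewrite -e3 ew e4.
move: ew; rewrite /w; lra.
Qed.

Lemma cyl_gap_right n m x : unit01 x -> (n + m <= M)%N ->
  let q := iter m T x in
  hi M x - x < hi n q - q -> d <= (hi n q - q) - (hi M x - x).
Proof.
move=> hx nmM q h; have mM : (m <= M)%N by lia.
have hq : unit01 q by exact: iter_unit01.
have /andP[h5 h6] := cyl_mem n hq; have /andP[h7 h8] := cyl_mem M hx.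
pose s := hi M x - x + q.
have hs : lo n q <= s < hi n q by apply/andP; split; rewrite /s; lra.
have us := cyl_unit01 hq hs.
have [z uz ez] := iter_onto m us.
have [e1 e2] := cyl_eq hq hs.
have := cyl_image_ends uz nmM; rewrite /= ez e1 e2 => -[h1 h2].
have /andP[h9 h10] := cyl_mem M uz.
have := dM uz.
suff : z <= lo M z by rewrite /s in h1 h2 *; lra.
rewrite leNgt; apply/negP => hc.
(* otherwise [s] is not the left end of the image cylinder around it, and that
   cylinder meets the one of [q] *)
pose w := Num.max (lo M z) (lo M x - x + q - s + z).
have hw : lo M z <= w < hi M z.
  by rewrite /w le_max lexx gt_max /s; apply/andP; split; lra.
pose v := w - z + s - q + x.
have hv : lo M x <= v < hi M x.
  rewrite /v /w /s in hc *.
  case: (leP (lo M z) (lo M x - x + q - (hi M x - x + q) + z)); lra.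
have ew : w = v.
  apply: (@iter_inj m); [exact: cyl_unit01 hw | exact: cyl_unit01 hv |].
  by rewrite (cyl_iter uz hw mM) (cyl_iter hx hv mM) ez -/q /v; ring.
have [_ e3] := cyl_eq uz hw; have [_ e4] := cyl_eq hx hv.
have : hi M z = hi M x by rewrite -e3 ew e4.
move: ew; rewrite /v /s; lra.
Qed.
End gaps.
End cylinders.

(** * Linear recurrence and returns *)

Section returns.
Variables (R : realType) (T lft rgt : R -> R).
Hypothesis HT : cellwise_translation T lft rgt.
Variables (kappa : nat) (c : R).
Hypothesis c_gt0 : 0 < c.
Hypothesis recurrent : forall n x z, (0 < n)%N -> unit01 x -> unit01 z ->
  exists2 k, (k + n <= kappa * n)%N & same_code T lft n x (iter k T z).
Hypothesis cyl_long : forall n x, (0 < n)%N -> unit01 x ->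
  c / n%:R <= hi T rgt n x - lo T lft n x.
Hypothesis aperiodic : forall m, (0 < m)%N ->
  ~ (forall x, unit01 x -> iter m T x = x).

Let kappa_gt0 : (0 < kappa)%N.
Proof.
have u0 : unit01 (0 : R) by rewrite /unit01 lexx ltr01.
have [k] := recurrent (n := 1) isT u0 u0; lia.
Qed.

(** Points with the same code move by the same amount, so [T ^ m] acts on the
    orbit of a point as the translation by a fixed number. Since the orbit is
    bounded, this number is zero. *)
Lemma periodic_codes m :
  (forall x, unit01 x -> lft x = lft (iter m T x)) ->
  forall x, unit01 x -> iter m T x = x.
Proof.
move=> hp x hx; set t := iter m T x - x.
have step y : unit01 y -> iter m T (iter m T y) - iter m T y = iter m T y - y.
  move=> hy; have hs : same_code T lft m y (iter m T y).
    move=> i _; rewrite -iterD addnC iterD; apply: hp.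
    exact: (iter_unit01 HT).
  have hc := same_code_cyl HT hy (iter_unit01 HT m hy) hs.
  rewrite (cyl_iter HT hy hc (leqnn m)); ring.
have arith j : iter (j * m) T x = x + j%:R * t /\
    iter m T (iter (j * m) T x) - iter (j * m) T x = t.
  elim: j => [|j [IH1 IH2]]; first by rewrite mul0n mul0r addr0.
  rewrite mulSn iterD; split.
    by rewrite -natr1 mulrDl mul1r addrA -IH1 -IH2; ring.
  by rewrite step ?IH2 //; exact: (iter_unit01 HT).
have bound j : `|j%:R * t| < 1.
  have /andP[h1 h2] := iter_unit01 HT (j * m) hx.
  have [e _] := arith j; rewrite e in h1 h2.
  by move/andP: hx => [h3 h4]; rewrite ltr_norml; apply/andP; split; lra.
have [/eqP|t0] := boolP (t == 0); first by rewrite /t => ?; lra.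
have at0 : 0 < `|t| by rewrite normr_gt0.
have := bound (Num.trunc (`|t|^-1)).+1.
rewrite normrM ger0_norm ?ler0n // -ltr_pdivlMr // div1r => h.
by have := lt_trans (truncnS_gt _) h; rewrite ltxx.
Qed.

(** A point that came back too close after time [m] would, because its
    cylinder of order [m] is long, have a neighbour whose code is periodic for
    so long that linear recurrence makes every code periodic. *)
Lemma return_far m x : (0 < m)%N -> unit01 x ->
  c / (2 * kappa)%:R / m%:R <= `|iter m T x - x|.
Proof.
move=> m0 hx; rewrite leNgt; apply/negP => small.
apply: (aperiodic m0); apply: periodic_codes.
(* [2 * kappa] periods are enough letters to see all words of length [m + 1] *)
set t := iter m T x - x in small; pose M := (2 * kappa)%N.
pose p := lo T lft m x; pose q := hi T rgt m x.
have pq : c / m%:R <= q - p by exact: cyl_long.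
have M0 : (0 : R) < M%:R by rewrite ltr0n muln_gt0 kappa_gt0.
have Mt : M%:R * `|t| < q - p.
  apply: lt_le_trans pq; rewrite mulrC -ltr_pdivlMr //.
  by rewrite (_ : c / m%:R / M%:R = c / M%:R / m%:R) // mulrAC.
have [z zP] : exists z, forall j, (j <= M)%N -> p <= z + j%:R * t < q.
  have [t0|t0] := leP 0 t.
    exists p => j jM; have jM' : (j%:R : R) <= M%:R by rewrite ler_nat.
    rewrite ger0_norm // in Mt.
    have : j%:R * t <= M%:R * t by rewrite ler_wpM2r.
    have : 0 <= j%:R * t by rewrite mulr_ge0.
    by move=> *; apply/andP; split; lra.
  exists (p - M%:R * t) => j jM; have jM' : (j%:R : R) <= M%:R by rewrite ler_nat.
  rewrite ltr0_norm // in Mt.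
  have : M%:R * t <= j%:R * t by rewrite ler_wnM2r // ltW.
  have : j%:R * t <= 0 by rewrite mulr_ge0_le0 // ltW.
  by move=> *; apply/andP; split; lra.
have uz : unit01 z.
  by apply: (cyl_unit01 HT hx (n := m)); have := zP 0%N isT; rewrite mul0r addr0.
have jump j : (j <= M)%N -> iter (j * m) T z = z + j%:R * t.
  elim: j => [|j IH] jM; first by rewrite mul0n mul0r addr0.
  have hj := zP j (ltnW jM).
  rewrite mulSn iterD IH; last exact: ltnW.
  by rewrite (cyl_iter HT hx hj (leqnn m)) -natr1 /t; ring.
have per k : (k < M * m)%N -> lft (iter (k + m) T z) = lft (iter k T z).
  move=> kM; have im : (k %% m < m)%N by rewrite ltn_mod.
  have jM : (k %/ m < M)%N by rewrite ltn_divLR.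
  have code j : (j <= M)%N -> lft (iter (k %% m + j * m) T z) = lft (iter (k %% m) T x).
    move=> hj; rewrite iterD jump //; apply/esym.
    by apply: (cyl_same_code HT hx (zP j hj)).
  rewrite {1 2}(divn_eq k m) [(_ + k %% m)%N]addnC (code _ (ltnW jM)).
  by rewrite -addnA -mulSnr code.
move=> y hy; have [k hk hs] := recurrent (n := m.+1) isT hy uz.
have := hs 0%N isT; have := hs m (ltnSn m); rewrite -iterD => -> /= ->.
rewrite addnC per //; rewrite /M; nia.
Qed.

End returns.

(** * One extra cut point *)

Section cut.
Variables (R : realType) (T lft rgt : R -> R) (zeta : R).
Hypothesis HT : cellwise_translation T lft rgt.

Definition cut_lft x := if zeta <= x then Num.max (lft x) zeta else lft x.
Definition cut_rgt x := if zeta <= x then rgt x else Num.min (rgt x) zeta.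

Lemma cut_cellwise_translation : cellwise_translation T cut_lft cut_rgt.
Proof.
split=> [x hx|x hx|x hx|x y hx].
- have := cell_mem HT hx; rewrite /cut_lft /cut_rgt.
  by case: (leP zeta x) => h1 /andP[h2 h3]; rewrite ?ge_max ?lt_min h2 h3 ?h1.
- have := cell_sub HT hx; rewrite /cut_lft /cut_rgt.
  by case: (leP zeta x) => h1 [h2 h3]; rewrite ?le_max ?ge_min h2 h3.
- exact: (cell_map HT).
rewrite /cut_lft /cut_rgt; case: (leP zeta x) => h1.
  rewrite ge_max => /andP[/andP[h2 h3] h4].
  by have [-> -> ->] := cell_trans HT hx (introT andP (conj h2 h4)); rewrite h3.
rewrite lt_min => /andP[h2 /andP[h3 h4]].
have [-> -> ->] := cell_trans HT hx (introT andP (conj h2 h3)).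
by rewrite leNgt h4.
Qed.

Notation lo' := (lo T cut_lft).
Notation hi' := (hi T cut_rgt).

(** The length of a refined cylinder is controlled through its ends, each of
    which comes from the original partition or from the cut point. *)
Lemma cut_loP n x : unit01 x -> lo T lft n x <= lo' n x /\
  (lo' n x = lo T lft n x \/ exists i, [/\ (i < n)%N, zeta <= iter i T x &
     lo' n x = x - (iter i T x - zeta)]).
Proof.
elim: n x => [|n IH] x hx; first by split; [|left].
have [h1 h2] := IH _ (cell_map HT hx).
have -> : lo' n.+1 x = Num.max (cut_lft x) (lo' n (T x) - (T x - x)) by [].
have -> : lo T lft n.+1 x = Num.max (lft x) (lo T lft n (T x) - (T x - x)) by [].
have h3 : lft x <= cut_lft x.
  by rewrite /cut_lft; case: (leP zeta x); rewrite ?le_max lexx.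
have h4 : cut_lft x = lft x \/ zeta <= x /\ cut_lft x = zeta.
  rewrite /cut_lft; case: (leP zeta x) => ?; last by left.
  by case: (leP (lft x) zeta) => ?; [right|left].
split; first by rewrite ge_max !le_max h3 /= lerD2r h1 orbT.
case: (leP (cut_lft x)) => h5; last first.
  case: h4 => [e|[zx e]].
    left; rewrite e; apply/esym/max_idPl; lra.
  by right; exists 0%N; split=> //=; lra.
case: h2 => [e|[i [hi zi e]]].
  left; rewrite e; apply/esym/max_idPr; rewrite e in h5; lra.
by right; exists i.+1; rewrite iterSr; split=> //; lra.
Qed.

Lemma cut_hiP n x : unit01 x -> hi' n x <= hi T rgt n x /\
  (hi' n x = hi T rgt n x \/ exists i, [/\ (i < n)%N, iter i T x < zeta &
     hi' n x = x + (zeta - iter i T x)]).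
Proof.
elim: n x => [|n IH] x hx; first by split; [|left].
have [h1 h2] := IH _ (cell_map HT hx).
have -> : hi' n.+1 x = Num.min (cut_rgt x) (hi' n (T x) - (T x - x)) by [].
have -> : hi T rgt n.+1 x = Num.min (rgt x) (hi T rgt n (T x) - (T x - x)) by [].
have h3 : cut_rgt x <= rgt x.
  by rewrite /cut_rgt; case: (leP zeta x); rewrite ?ge_min lexx.
have h4 : cut_rgt x = rgt x \/ x < zeta /\ cut_rgt x = zeta.
  rewrite /cut_rgt; case: (leP zeta x) => ?; first by left.
  by case: (leP (rgt x) zeta) => ?; [left|right].
split; first by rewrite le_min !ge_min h3 /= lerD2r h1 orbT.
case: (leP (cut_rgt x)) => h5.
  case: h4 => [e|[zx e]].
    left; rewrite e; apply/esym/min_idPl; lra.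
  by right; exists 0%N; split=> //=; lra.
case: h2 => [e|[i [hi zi e]]].
  left; rewrite e; apply/esym/min_idPr; rewrite e in h5; lra.
by right; exists i.+1; rewrite iterSr; split=> //; lra.
Qed.

Variables (c c2 : R).
Hypothesis c_gt0 : 0 < c.
Hypothesis c2_gt0 : 0 < c2.
Hypothesis T_onto : forall y, unit01 y -> exists2 x, unit01 x & T x = y.
Hypothesis T_inj : forall x y, unit01 x -> unit01 y -> T x = T y -> x = y.
Hypothesis cyl_long : forall n x, (0 < n)%N -> unit01 x ->
  c / n%:R <= hi T rgt n x - lo T lft n x.
Hypothesis return_far : forall m x, (0 < m)%N -> unit01 x ->
  c2 / m%:R <= `|iter m T x - x|.
Hypothesis zeta01 : unit01 zeta.

(** The point [y] stands for [T^-n zeta], so its cylinder of order [2 * n] is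
    the two-sided cylinder of the cut point. If both ends of a refined cylinder
    come from the cut point, some point returns at a distance equal to the
    length of the refined cylinder. If only one end does, then that cylinder,
    moved to the cut point, reaches from it to an end of a one-sided cylinder,
    at least as far as the end of the two-sided cylinder; when the latter end
    is the cut point itself, it remains to use that gaps between ends are
    long. *)
Lemma cut_cyl_long n d y : (0 < n)%N ->
  unit01 y -> iter n T y = zeta ->
  d <= c / (2 * n)%:R -> d <= c2 / n%:R ->
  d <= hi T rgt (2 * n) y - y ->
  (lo T lft (2 * n) y = y \/ d <= y - lo T lft (2 * n) y) ->
  forall x, unit01 x -> d <= hi' n x - lo' n x.
Proof.
move=> n0 uy ey dc dc2 db da x hx.
have [/andP[h1 h2] /andP[h3 h4]] :=
  (cyl_mem HT n hx, cyl_mem cut_cellwise_translation n hx).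
have nat2 : (n%:R : R) <= (2 * n)%:R by rewrite ler_nat leq_pmull.
have n0' : (0 : R) < n%:R by rewrite ltr0n.
have dcn : d <= c / n%:R.
  apply: le_trans dc _.
  by rewrite ler_pM2l // lef_pV2 ?posrE // ltr0n muln_gt0.
have n20 : (0 < 2 * n)%N by rewrite muln_gt0.
have long := cyl_long n0 hx.
have pre i p : (i < n)%N -> unit01 p -> iter i T p = zeta -> iter (n - i) T y = p.
  move=> lt_in up ep; apply: (iter_inj HT T_inj (m := i)) => //; first exact: (iter_unit01 HT).
  by rewrite -iterD subnKC ?ey // ltnW.
have [lo_le [elo|[i [lt_in zi elo]]]] := cut_loP n hx;
have [hi_ge [ehi|[j [lt_jn zj ehi]]]] := cut_hiP n hx; rewrite ?elo ?ehi in lo_le hi_ge h3 h4 *.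
- lra.
- have [->|ne] := eqVneq (x + (zeta - iter j T x)) (hi T rgt n x); first lra.
  pose q := x + (zeta - iter j T x).
  have hq : lo T lft n x <= q < hi T rgt n x.
    by rewrite lt_neqAle ne hi_ge andbT /q; lra.
  have uq := cyl_unit01 HT hx hq.
  have eq : iter j T q = zeta by rewrite (cyl_iter HT hx hq (ltnW lt_jn)) /q; ring.
  have [e1 _] := cyl_eq HT hx hq.
  have ep := pre _ _ lt_jn uq eq.
  have le2 : (n + (n - j) <= 2 * n)%N by rewrite mul2n -addnn leq_add2l leq_subr.
  have := cyl_image_ends HT uy le2; rewrite /= ep e1 => -[k1 k2].
  have := cyl_gap_left HT T_onto T_inj (fun x => cyl_long (n := (2 * n)%N) (x := x) n20) uy le2.
  rewrite /= ep e1 /q in k1 k2 * => gap.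
  case: da => [e|]; last lra.
  have : c / (2 * n)%:R <= lo T lft (2 * n) y - y - (lo T lft n x - (x + (zeta - iter j T x))).
    by apply: gap; lra.
  lra.
- pose q := x - (iter i T x - zeta).
  have hq : lo T lft n x <= q < hi T rgt n x by apply/andP; rewrite /q; split; lra.
  have uq := cyl_unit01 HT hx hq.
  have eq : iter i T q = zeta by rewrite (cyl_iter HT hx hq (ltnW lt_in)) /q; ring.
  have [_ e1] := cyl_eq HT hx hq.
  have ep := pre _ _ lt_in uq eq.
  have le2 : (n + (n - i) <= 2 * n)%N by rewrite mul2n -addnn leq_add2l leq_subr.
  have := cyl_image_ends HT uy le2; rewrite /= ep e1 /q => -[k1 k2]; lra.
- have far m u : (0 < m < n)%N -> unit01 u -> d <= `|iter m T u - u|.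
    move=> /andP[m0 mn] uu; apply: le_trans (return_far m0 uu).
    apply: le_trans dc2 _; rewrite ler_pM2l // lef_pV2 ?posrE ?ltr0n //.
    by rewrite ler_nat ltnW.
  have -> : x + (zeta - iter j T x) - (x - (iter i T x - zeta)) =
    `|iter i T x - iter j T x| by rewrite ger0_norm; lra.
  have [ij|ij|ij] := ltngtP i j; last by rewrite ij in zi; lra.
  + rewrite distrC -(subnK (ltnW ij)) iterD; apply: far.
      by rewrite subn_gt0 ij (leq_ltn_trans (leq_subr _ _)).
    exact: (iter_unit01 HT).
  + rewrite -(subnK (ltnW ij)) iterD; apply: far.
      by rewrite subn_gt0 ij (leq_ltn_trans (leq_subr _ _)).
    exact: (iter_unit01 HT).
Qed.

Lemma scale_between (d s : R) n : (0 < n)%N -> 0 < s -> s < d / n%:R ->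
  exists2 n', (n <= n')%N & d / n'%:R <= s <= 2 * (d / n'%:R).
Proof.
move=> n0 s0 sd; have n0' : (0 : R) < n%:R by rewrite ltr0n.
have ds : n%:R < d / s by rewrite ltr_pdivlMr // mulrC -ltr_pdivlMr.
have n1 : (1 : R) <= n%:R by rewrite ler1n.
exists (Num.trunc (d / s)).+1.
  by rewrite ltnW // ltnS truncn_ge_nat ?ltW //; apply: lt_trans ds.
set n' := (Num.trunc _).+1.
have h1 : d / s < n'%:R by exact: truncnS_gt.
have h2 : n'%:R <= d / s + 1 by rewrite /n' -natr1 lerD2r truncn_le; lra.
have n'0 : (0 : R) < n'%:R by rewrite ltr0n.
have e : d = d / s * s by rewrite divfK ?gt_eqF.
by rewrite ler_pdivrMr // mulrA ler_pdivlMr //; apply/andP; split; nra.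
Qed.

(** If the two-sided cylinder of order [n] has an end very close to the cut
    point, then that end stays an end of the two-sided cylinders up to an order
    comparable with the inverse of its distance to the cut point, since ends
    are well spaced. At that order the distance is no longer small. *)
Lemma cut_cyl_long_often : exists2 d, 0 < d & forall n0, exists2 n,
  (n0 <= n)%N & (0 < n)%N /\
  forall x, unit01 x -> d / n%:R <= hi' n x - lo' n x.
Proof.
(* An end is at a distance at most [2 * (d / n)] from the cut point at the order
   [n] chosen for it. The factor 8 makes gaps and cylinders of order [2 * n]
   longer than [4 * (d / n)], so the end has not moved and the other end is
   far. *)
have c8 : 0 < c / 8 by rewrite divr_gt0.
exists (Num.min (c / 8) c2) => [|n0]; first by rewrite lt_min c8.
set d := Num.min _ _.
have d0 : 0 < d by rewrite lt_min c8.
have dc : d <= c / 8 by rewrite ge_min lexx.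
have dc2 : d <= c2 by rewrite ge_min lexx orbT.
have scale n : (0 < n)%N -> 4 * (d / n%:R) <= c / (2 * n)%:R /\ d / n%:R <= c2 / n%:R.
  move=> n1; have n1' : 0 < (n%:R : R)^-1 by rewrite invr_gt0 ltr0n.
  rewrite natrM invfM !mulrA; split; rewrite ler_pM2r //; lra.
suff [n n0n [n1 [y [uy ey hb ha]]]] : exists2 n, (n0 <= n)%N & (0 < n)%N /\
    exists y, [/\ unit01 y, iter n T y = zeta,
      d / n%:R <= hi T rgt (2 * n) y - y &
      lo T lft (2 * n) y = y \/ d / n%:R <= y - lo T lft (2 * n) y].
  exists n => //; split=> //; apply: (cut_cyl_long n1 uy ey) => //.
  - have [h _] := scale n n1; have : 0 < d / n%:R by rewrite divr_gt0 // ltr0n.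
    by move: h; lra.
  - by have [] := scale n n1.
pose n := n0.+1; have [y uy ey] := iter_onto T_onto n zeta01.
have [/andP[la hb]] := (cyl_mem HT (2 * n) uy).
have long n' y' : (0 < n')%N -> unit01 y' ->
    4 * (d / n'%:R) <= hi T rgt (2 * n') y' - lo T lft (2 * n') y'.
  move=> n'0 uy'; have [h _] := scale n' n'0; apply: le_trans h _.
  by apply: cyl_long => //; rewrite muln_gt0.
have pos n' : (0 < n')%N -> 0 < d / n'%:R by move=> ?; rewrite divr_gt0 // ltr0n.
have later n' : (n <= n')%N -> exists y', [/\ unit01 y', iter n' T y' = zeta,
    lo T lft (2 * n) y - y <  lo T lft (2 * n') y' - y' ->
    4 * (d / n'%:R) <= (lo T lft (2 * n') y' - y') - (lo T lft (2 * n) y - y),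
    hi T rgt (2 * n') y' - y' < hi T rgt (2 * n) y - y ->
    4 * (d / n'%:R) <= (hi T rgt (2 * n) y - y) - (hi T rgt (2 * n') y' - y') &
    lo T lft (2 * n) y - y <= lo T lft (2 * n') y' - y' /\
    hi T rgt (2 * n') y' - y' <= hi T rgt (2 * n) y - y].
  move=> nn'; have [y' uy' ey'] := iter_onto T_onto n' zeta01.
  have n'0 : (0 < n')%N by exact: leq_trans nn'.
  have e : iter (n' - n) T y' = y.
    apply: (iter_inj HT T_inj (m := n)) => //; first exact: (iter_unit01 HT).
    by rewrite -iterD subnKC ?ey'.
  have le2 : (2 * n + (n' - n) <= 2 * n')%N.
    by rewrite !mul2n -!addnn -addnA subnKC // leq_add2r.
  have lg u : unit01 u -> 4 * (d / n'%:R) <= hi T rgt (2 * n') u - lo T lft (2 * n') u.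
    exact: long.
  have := cyl_image_ends HT uy' le2; rewrite /= e => -[k1 k2].
  have g1 := cyl_gap_left HT T_onto T_inj lg uy' le2.
  have g2 := cyl_gap_right HT T_onto T_inj lg uy' le2.
  by rewrite /= e in g1 g2; exists y'; split.
have n1 : (0 < n)%N by [].
have := long n y n1 uy; have := pos n n1.
have [a0|a0] := eqVneq (lo T lft (2 * n) y) y.
  by exists n => //; split=> //; exists y; split=> //; [lra|left].
have a0' : 0 < y - lo T lft (2 * n) y by rewrite subr_gt0 lt_neqAle a0.
move=> h1 h2.
have [ha|ha] := leP (d / n%:R) (y - lo T lft (2 * n) y); last first.
  have [n' nn' /andP[k1 k2]] := scale_between n1 a0' ha.
  have n'0 : (0 < n')%N by exact: leq_trans nn'.
  have [y' [uy' ey' g1 _ [m1 m2]]] := later n' nn'.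
  have p' := pos n' n'0; have l' := long n' y' n'0 uy'.
  have e : lo T lft (2 * n) y - y = lo T lft (2 * n') y' - y'.
    apply/eqP; rewrite eq_le m1 leNgt; apply/negP => /g1.
    by have /andP[] := cyl_mem HT (2 * n') uy'; lra.
  exists n'; first exact: leq_trans (leqnSn _) nn'.
  by split=> //; exists y'; split=> //; [|right]; lra.
have [hb'|hb'] := leP (d / n%:R) (hi T rgt (2 * n) y - y).
  by exists n => //; split=> //; exists y; split=> //; right.
have b0' : 0 < hi T rgt (2 * n) y - y by rewrite subr_gt0.
have [n' nn' /andP[k1 k2]] := scale_between n1 b0' hb'.
have n'0 : (0 < n')%N by exact: leq_trans nn'.
have [y' [uy' ey' _ g1 [m1 m2]]] := later n' nn'.
have p' := pos n' n'0; have l' := long n' y' n'0 uy'.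
have e : hi T rgt (2 * n) y - y = hi T rgt (2 * n') y' - y'.
  apply/eqP; rewrite eq_le m2 andbT leNgt; apply/negP => /g1.
  by have /andP[] := cyl_mem HT (2 * n') uy'; lra.
exists n'; first exact: leq_trans (leqnSn _) nn'.
by split=> //; exists y'; split=> //; [|right]; lra.
Qed.
End cut.

(** * Interval exchanges *)

Section subdivision.
Variables (R : realType) (r : nat) (l : 'I_r -> R).
Hypothesis l_gt0 : forall i, 0 < l i.
Hypothesis l_sum : \sum_(i < r) l i = 1.

Definition psum (k : nat) : R := \sum_(j < r | (j < k)%N) l j.

Lemma psumS (i : 'I_r) : psum i.+1 = psum i + l i.
Proof.
rewrite /psum (bigD1 i) /= ?ltnSn // addrC; congr (_ + _).
by apply: eq_bigl => j; rewrite ltnS ltn_neqAle andbC -val_eqE.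
Qed.

Lemma psum0 : psum 0 = 0.
Proof. by rewrite /psum big1. Qed.

Lemma psum_r : psum r = 1.
Proof. by rewrite -l_sum; apply: eq_bigl => j; rewrite ltn_ord. Qed.

Lemma le_psum k k' : (k <= k')%N -> psum k <= psum k'.
Proof.
move=> kk'; rewrite /psum [leRHS](bigID (fun j : 'I_r => (j < k)%N)) /=.
have -> : \sum_(j < r | (j < k')%N && (j < k)%N) l j = \sum_(j < r | (j < k)%N) l j.
  by apply: eq_bigl => j; case: (ltnP j k) => jk; rewrite ?andbT ?andbF // (leq_trans jk).
by rewrite lerDl sumr_ge0 // => j _; exact: ltW.
Qed.

Lemma psum_find x : unit01 x -> exists i : 'I_r, psum i <= x < psum i.+1.
Proof.
move=> /andP[x0 x1].
have ex : exists k, x < psum k by exists r; rewrite psum_r.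
case: (ex_minnP ex) => [[|k]] hk kmin; first by move: hk; rewrite psum0; lra.
have kr : (k < r)%N by rewrite -ltnS; apply/kmin; rewrite psum_r.
exists (Ordinal kr); rewrite /= hk andbT leNgt; apply/negP => /kmin.
by rewrite ltnn.
Qed.

Lemma psum_inj x (i j : 'I_r) :
  psum i <= x < psum i.+1 -> psum j <= x < psum j.+1 -> i = j.
Proof.
move=> /andP[h1 h2] /andP[h3 h4]; apply/val_inj/eqP => /=.
rewrite eqn_leq; apply/andP; split; rewrite leqNgt; apply/negP => /le_psum; lra.
Qed.
End subdivision.

Section iet_cells.
Variables (R : realType) (r : nat) (lam : 'I_r -> R) (pi : 'S_r).
Hypothesis lam_gt0 : forall i, 0 < lam i.
Hypothesis lam_sum : \sum_(i < r) lam i = 1.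

Notation T := (iet lam pi).
Notation lamp := (fun k => lam (pi k)).
Notation sigma i := ((pi^-1)%g i).

Definition iet_lft x : R :=
  if [pick i | x \in iet_interval lam i] is Some i then psum lam i else 0.
Definition iet_rgt x : R :=
  if [pick i | x \in iet_interval lam i] is Some i then psum lam i.+1 else 1.

Let lamp_gt0 k : 0 < lamp k. Proof. exact: lam_gt0. Qed.
Let lamp_sum : \sum_(k < r) lamp k = 1.
Proof. by rewrite -lam_sum [RHS](reindex_inj (@perm_inj _ pi)). Qed.

Lemma iet_intervalE (i : 'I_r) x : (x \in iet_interval lam i) = (psum lam i <= x < psum lam i.+1).
Proof. by apply/idP/idP; rewrite inE /iet_interval /= in_itv. Qed.

Lemma iet_pick (i : 'I_r) x : psum lam i <= x < psum lam i.+1 ->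
  [pick i | x \in iet_interval lam i] = Some i.
Proof.
move=> hx; case: pickP => [j|/(_ i)]; rewrite iet_intervalE ?hx //.
by move=> /(psum_inj lam_gt0 hx) ->.
Qed.

(** The images of the exchanged intervals form the subdivision of the unit
    interval with the lengths permuted by [pi]. *)
Lemma psum_image (i : 'I_r) : \sum_(j < r | (sigma j < sigma i)%N) lam j = psum lamp (sigma i).
Proof.
rewrite /psum (reindex_inj (@perm_inj _ pi)) /=.
by apply: eq_bigl => k; rewrite permK.
Qed.

Lemma ietE (i : 'I_r) x : psum lam i <= x < psum lam i.+1 ->
  [/\ iet_lft x = psum lam i, iet_rgt x = psum lam i.+1 &
      T x = x + psum lamp (sigma i) - psum lam i].
Proof.
by move=> hx; rewrite /iet_lft /iet_rgt /iet (iet_pick hx) psum_image.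
Qed.

Lemma iet_image (i : 'I_r) x : psum lam i <= x < psum lam i.+1 ->
  psum lamp (sigma i) <= T x < psum lamp (sigma i).+1.
Proof.
move=> hx; have [_ _ ->] := ietE hx; move: hx; rewrite !psumS permKV; lra.
Qed.

Lemma iet_cellwise : cellwise_translation T iet_lft iet_rgt.
Proof.
split=> [x|x|x|x y] /(psum_find lam_sum) [i hi]; have [e1 e2 e3] := ietE hi.
- by rewrite e1 e2.
- rewrite e1 e2 -(psum0 lam) -(psum_r lam_sum).
  by split; apply: le_psum => //; exact: ltn_ord.
- have /andP[h1 h2] := iet_image hi; apply/andP; split.
    by apply: le_trans h1; rewrite -(psum0 lamp); exact: le_psum.
  by apply: lt_le_trans h2 _; rewrite -(psum_r lamp_sum); exact/le_psum/ltn_ord.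
rewrite e1 e2 => hy; have [-> -> ->] := ietE hy.
by split=> //; rewrite e3; ring.
Qed.

Lemma iet_onto y : unit01 y -> exists2 x, unit01 x & T x = y.
Proof.
move=> /(psum_find lamp_sum) [k hk]; pose i := pi k.
pose x := y - psum lamp k + psum lam i.
have hx : psum lam i <= x < psum lam i.+1.
  by move: hk; rewrite !psumS /x /i; lra.
exists x.
  move: hx => /andP[h1 h2]; apply/andP; split.
    by apply: le_trans h1; rewrite -(psum0 lam); exact: le_psum.
  by apply: lt_le_trans h2 _; rewrite -(psum_r lam_sum); exact/le_psum/ltn_ord.
by have [_ _ ->] := ietE hx; rewrite /i permK /x; ring.
Qed.

Lemma iet_inj x y : unit01 x -> unit01 y -> T x = T y -> x = y.
Proof.
move=> /(psum_find lam_sum) [i hi] /(psum_find lam_sum) [j hj] e.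
have := iet_image hj; rewrite -e => /(psum_inj lamp_gt0 (iet_image hi)).
move=> /perm_inj ij; have [_ _ e1] := ietE hi; have [_ _ e2] := ietE hj.
by move: e; rewrite e1 e2 ij; lra.
Qed.

(** Every point of the unit interval has a trajectory, so the words of the
    language are the codes of points, and an occurrence of the code of [x] in
    that of [z] is a visit of [z] to the cylinder of [x]. *)
Lemma linearly_recurrent_codes : linearly_recurrent lam pi ->
  exists kappa, forall n x z, (0 < n)%N -> unit01 x -> unit01 z ->
    exists2 k, (k + n <= kappa * n)%N & same_code T iet_lft n x (iter k T z).
Proof.
move=> [K hK].
have u0 : unit01 (0 : R) by rewrite /unit01 lexx ltr01.
have [i0 _] := psum_find lam_sum u0.
pose idx x := odflt i0 [pick i | x \in iet_interval lam i].
have idxE x : unit01 x -> iet_interval lam (idx x) x /\ iet_lft x = psum lam (idx x).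
  move=> /(psum_find lam_sum) [i hi]; have [-> _ _] := ietE hi.
  by rewrite /idx (iet_pick hi) /=; split=> //; rewrite -inE iet_intervalE.
have word x n : unit01 x -> language lam pi (mkseq (fun i => idx (iter i T x)) n).
  move=> hx; exists x, (fun i => idx (iter i T x)); split.
  - by rewrite /= in_itv.
  - by move=> i; have [] := idxE _ (iter_unit01 iet_cellwise i hx).
  - by exists 0%N; rewrite size_mkseq.
exists (Num.trunc `|K|).+1 => n x z n0 hx hz.
pose W := ((Num.trunc `|K|).+1 * n)%N.
have := hK _ _ (word x n hx) (word z W hz); rewrite !size_mkseq.
have KW : K * n%:R <= W%:R.
  rewrite /W natrM ler_wpM2r //; apply: le_trans (ler_norm K) _.
  by apply: ltW; exact: truncnS_gt.
move=> /(_ KW) /infixP[s1 [s2 e]].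
have sz := congr1 size e; rewrite !size_cat !size_mkseq in sz.
exists (size s1); first by rewrite -/W sz leq_add2l leq_addr.
move=> i lt_in; have := congr1 (fun s => nth i0 s (size s1 + i)) e.
have lt_W : (size s1 + i < W)%N by rewrite sz ltn_add2l ltn_addr.
rewrite nth_mkseq // nth_cat ltnNge leq_addr /= addKn nth_cat size_mkseq lt_in.
rewrite nth_mkseq // => e'.
have [_ ->] := idxE _ (iter_unit01 iet_cellwise i hx).
have [_] := idxE _ (iter_unit01 iet_cellwise (i + size s1) hz).
by rewrite -iterD => ->; rewrite addnC e'.
Qed.
End iet_cells.

(** * Lebesgue measure on the phase space *)

Section lebesgue_shift.
Variable R : realType.

Lemma measurable_shift (t : R) :
  measurable_fun [set: measurableTypeR R] ((fun x => x + t) : R -> measurableTypeR R).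
Proof.
by apply: continuous_measurable_fun => x; apply: cvgD; [exact: cvg_id|exact: cvg_cst].
Qed.

Lemma measurable_shift_preimage (t : R) (A : set R) : measurable A ->
  measurable ((fun x => x + t) @^-1` A).
Proof. by move=> mA; rewrite -[X in measurable X]setTI; apply: measurable_shift. Qed.

Lemma lebesgue_shift (t : R) (A : set R) : measurable A ->
  lebesgue_measure ((fun x => x + t) @^-1` A) = lebesgue_measure A.
Proof.
move=> mA; apply/esym.
pose m : {measure set (measurableTypeR R) -> \bar R} :=
  measure_function_pushforward__canonical__measure_function_Measure
    (@lebesgue_measure R) (measurable_shift t).
suff h : forall X, ocitv X -> lebesgue_measure X = m X.
  exact: (lebesgue_measure_unique h mA).
move=> _ /ocitvP[->|[[a b] /= ab ->]]; first by rewrite !measure0.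
rewrite /m /= /pushforward.
have -> : (fun x => x + t) @^-1` `]a, b]%classic = `]a - t, b - t]%classic.
  by apply/seteqP; split=> x /=; rewrite !in_itv /= ltrBlDr lerBrDr.
rewrite [RHS]lebesgue_measure_itv [LHS]lebesgue_measure_itv /= !lte_fin ltrD2r.
by rewrite -!EFinB; case: ifP => // _; congr EFin; ring.
Qed.
End lebesgue_shift.

Notation U01 R := (`[(0 : R), 1[%classic).

Lemma mem_bigsetU (I : finType) (X : Type) (F : I -> set X) x :
  (\big[setU/set0]_(i : I) F i) x <-> exists i, F i x.
Proof.
rewrite -bigcup_seq; split=> [[i _ Fx]|[i Fx]]; first by exists i.
by exists i => //=; rewrite mem_index_enum.
Qed.

Section partition_measure.
Variables (R : realType) (r : nat) (l : 'I_r -> R).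
Hypothesis l_gt0 : forall i, 0 < l i.
Hypothesis l_sum : \sum_(i < r) l i = 1.
Notation itv i := (`[psum l i, psum l i.+1[%classic).

Lemma partition_unit01 (F : set R) :
  U01 R `&` F = \big[setU/set0]_(i < r) (itv i `&` F).
Proof.
apply/seteqP; split=> x.
  rewrite /= in_itv /= => -[/(psum_find l_sum) [i hi] Fx].
  by apply/mem_bigsetU; exists i => //; split=> //; rewrite /= in_itv.
move=> /mem_bigsetU [i [/=]]; rewrite !in_itv /= => /andP[h1 h2] Fx.
split=> //; apply/andP; split.
  by apply: le_trans h1; rewrite -(psum0 l); exact: le_psum.
by apply: lt_le_trans h2 _; rewrite -(psum_r l_sum); exact/le_psum/ltn_ord.
Qed.

Lemma partition_measure (F : set R) : 
  (forall i : 'I_r, measurable (itv i `&` F)) ->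
  measurable (U01 R `&` F) /\
  lebesgue_measure (U01 R `&` F) = (\sum_(i < r) lebesgue_measure (itv i `&` F))%E.
Proof.
move=> mF; rewrite partition_unit01; split; first exact: bigsetU_measurable.
rewrite (measure_bigsetU_ord (@lebesgue_measure R) xpredT (F := fun i => itv i `&` F)) //.
apply/trivIsetP => /= i j _ _ /eqP ij; apply/seteqP; split=> // x [[/=]].
rewrite !in_itv /= => hi _ [hj _]; apply: ij; exact: (psum_inj l_gt0 hi hj).
Qed.
End partition_measure.

Section iet_measure.
Variables (R : realType) (r : nat) (lam : 'I_r -> R) (pi : 'S_r).
Hypothesis lam_gt0 : forall i, 0 < lam i.
Hypothesis lam_sum : \sum_(i < r) lam i = 1.
Notation T := (iet lam pi).
Notation lamp := (fun k => lam (pi k)).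
Notation sigma i := ((pi^-1)%g i).
Let lamp_gt0 k : 0 < lamp k. Proof. exact: lam_gt0. Qed.
Let lamp_sum : \sum_(k < r) lamp k = 1.
Proof. by rewrite -lam_sum [RHS](reindex_inj (@perm_inj _ pi)). Qed.

Lemma iet_measure_preserving (E : set R) : measurable E ->
  measurable (U01 R `&` T @^-1` E) /\
  lebesgue_measure (U01 R `&` T @^-1` E) = lebesgue_measure (U01 R `&` E).
Proof.
move=> mE.
have e (i : 'I_r) : `[psum lam i, psum lam i.+1[%classic `&` T @^-1` E =
    (fun x => x + (psum lamp (sigma i) - psum lam i)) @^-1`
      (`[psum lamp (sigma i), psum lamp (sigma i).+1[%classic `&` E).
  apply/seteqP; split=> x /=; rewrite !in_itv /=.
    move=> [hi Ex]; have := iet_image pi lam_gt0 hi.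
    by have [_ _ e] := ietE pi lam_gt0 hi; move: Ex; rewrite e addrA.
  rewrite !psumS permKV addrA => -[hi Ex].
  have hx : psum lam i <= x < psum lam i.+1 by move: hi; rewrite psumS; lra.
  by have [_ _ ->] := ietE pi lam_gt0 hx; split=> //; move: hx; rewrite psumS.
have [m1 ->] : measurable (U01 R `&` T @^-1` E) /\ lebesgue_measure (U01 R `&` T @^-1` E) =
    (\sum_(i < r) lebesgue_measure (`[psum lam i, psum lam i.+1[%classic `&` T @^-1` E))%E.
  apply: partition_measure => // i; rewrite e.
  by apply: measurable_shift_preimage; apply: measurableI.
split=> //.
have [_ ->] := partition_measure lamp_gt0 lamp_sum (fun i => measurableI _ _ (measurable_itv _) mE).
rewrite [RHS](reindex_inj (@perm_inj _ (pi^-1)%g)) /=.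
by apply: eq_bigr => i _; rewrite e lebesgue_shift //; apply: measurableI.
Qed.
End iet_measure.

Section phase_measure.
Variables (R : realType) (N : nat).

(** Lebesgue measure on the Borel sets of [R] itself, whose product with the
    discrete sets of ['Z_N] is the measurable structure of the phase space. *)
Definition leb (A : set R) : \bar R := lebesgue_measure A.

Let leb0 : leb set0 = 0%E. Proof. exact: measure0. Qed.
Let leb_ge0 A : (0 <= leb A)%E. Proof. exact: measure_ge0. Qed.
Let leb_sigma_additive : semi_sigma_additive leb.
Proof. exact: (@measure_semi_sigma_additive _ _ _ (@lebesgue_measure R)). Qed.
HB.instance Definition _ :=
  @isMeasure.Build _ R R leb leb0 leb_ge0 leb_sigma_additive.

Notation P := (R * 'Z_N)%type.

Definition slice_measure (s : 'Z_N) : {measure set P -> \bar R} :=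
  measure_function_pushforward__canonical__measure_function_Measure
    (mrestr leb (measurable_itv `[0, 1[)) (pair2_measurable s).

Definition phase_measure : {measure set P -> \bar R} :=
  msum (fun k => slice_measure (inord k)) (Zp_trunc N).+2.

Lemma phase_measureE A : 
  phase_measure A = (\sum_(s : 'Z_N) lebesgue_measure (U01 R `&` ysection A s))%E.
Proof.
rewrite /phase_measure /= /msum; apply: eq_bigr => s _.
rewrite /= /pushforward /mrestr /= inord_val setIC; congr (lebesgue_measure (_ `&` _)).
by apply/seteqP; split=> x /=; rewrite ysectionE.
Qed.
End phase_measure.

(** * The skew product *)

Section skew.
Variables (R : realType) (N : nat) (T : R -> R) (zeta : R) (a1 a2 : int).
Hypothesis T_map : forall x, unit01 x -> unit01 (T x).
Hypothesis T_inj : forall x y, unit01 x -> unit01 y -> T x = T y -> x = y.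
Hypothesis T_preserving : forall E : set R, measurable E ->
  measurable (U01 R `&` T @^-1` E) /\
  lebesgue_measure (U01 R `&` T @^-1` E) = lebesgue_measure (U01 R `&` E).

Notation P := (R * 'Z_N)%type.
Notation f := (@two_step R N zeta a1 a2).
Notation S := (skew T f).
Notation X := (@phase_space R N).

Lemma phase_spaceE (p : P) : X p <-> unit01 p.1.
Proof. by rewrite /phase_space /= in_itv /=; split=> [[]|]. Qed.

Lemma skew_map p : X p -> X (S p).
Proof. by move=> /phase_spaceE hp; apply/phase_spaceE; exact: T_map. Qed.

Lemma skew_inj p q : X p -> X q -> S p = S q -> p = q.
Proof.
case: p q => [x s] [y t] /phase_spaceE hx /phase_spaceE hy eS.
have e1 : T x = T y := congr1 fst eS.
have e2 : s + f x = t + f y := congr1 snd eS.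
have /= e := T_inj hx hy e1.
by move: e2; rewrite e => h; rewrite (addIr _ h).
Qed.

Lemma measurable_slices (A : set P) :
  (forall s, measurable (ysection A s)) -> measurable A.
Proof.
move=> mA.
have -> : A = \big[setU/set0]_(s : 'Z_N) (ysection A s `*` [set s]).
  apply/seteqP; split=> [[x s] Axs|[x s]].
    by apply/mem_bigsetU; exists s; split=> //=; rewrite ysectionE.
  by move=> /mem_bigsetU [t [/= + ->]]; rewrite ysectionE.
by apply: bigsetU_measurable => s _; apply: measurableX.
Qed.

Lemma measurable_phase_space : measurable X.
Proof. by apply: measurableX; [exact: measurable_itv|exact: measurableT]. Qed.

Lemma ysection_skew (A : set P) s : ysection (X `&` S @^-1` A) s =
  (U01 R `&` T @^-1` (ysection A (s + a1%:~R)) `&` `]-oo, zeta[%classic) `|`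
  (U01 R `&` T @^-1` (ysection A (s + a2%:~R)) `&` `[zeta, +oo[%classic).
Proof.
apply/seteqP; split=> x.
  rewrite !ysectionE /= !in_itv /= andbT /two_step => -[[hx _]].
  by rewrite /skew /=; case: ltP => hz Ax; [left|right].
rewrite !ysectionE /= !in_itv /= andbT /skew /= /two_step.
by case=> -[[hx Ax] hz]; split=> //; [rewrite hz|rewrite ltNge hz].
Qed.

Lemma measurable_skew (A : set P) : measurable A -> measurable (X `&` S @^-1` A).
Proof.
move=> mA; apply: measurable_slices => s; rewrite ysection_skew.
have mV t : measurable (U01 R `&` T @^-1` ysection A t).
  by have [] := T_preserving (measurable_ysection t mA).
by apply: measurableU; apply: (measurableI _ _ (mV _)); exact: measurable_itv.
Qed.

Notation Lam := (@phase_measure R N).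

Lemma phase_measure_skew (A : set P) : measurable A ->
  Lam (X `&` S @^-1` A) = Lam A.
Proof.
move=> mA; rewrite !phase_measureE.
pose V s := U01 R `&` T @^-1` (ysection A s).
have mV s : measurable (V s) by have [] := T_preserving (measurable_ysection s mA).
transitivity (\sum_(s : 'Z_N) (leb (V (s + a1%:~R)%R `&` `]-oo, zeta[%classic) +
    leb (V (s + a2%:~R)%R `&` `[zeta, +oo[%classic)))%E.
  apply: eq_bigr => s _; rewrite ysection_skew -/(V _) -/(V _).
  rewrite -[lebesgue_measure _]/(leb _) -measureU.
  - congr leb; rewrite setIUr; congr setU; rewrite setIA.
      by congr setI; rewrite /V setIA setIid.
    by congr setI; rewrite /V setIA setIid.
  - by apply: measurableI => //; exact: measurable_itv.
  - by apply: measurableI => //; exact: measurable_itv.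
  apply/seteqP; split=> // x [[_ h1] [_ h2]]; move: h1 h2.
  by rewrite /= !in_itv /= andbT => ?; rewrite leNgt => /negP.
rewrite big_split /=.
have shift (F : 'Z_N -> \bar R) a :
  (\sum_(s : 'Z_N) F (s + a)%R = \sum_(s : 'Z_N) F s)%E.
  by rewrite [RHS](reindex_inj (addIr a)).
rewrite (shift (fun s => leb (V s `&` `]-oo, zeta[%classic))).
rewrite (shift (fun s => leb (V s `&` `[zeta, +oo[%classic))).
rewrite -big_split /=; apply: eq_bigr => s _.
have [_ <-] := T_preserving (measurable_ysection s mA).
rewrite -[RHS]/(leb (V s)) -measureU.
- rewrite -setIUr; congr leb; apply/seteqP; split=> [x []//|x Vx]; split=> //.
  by rewrite /= !in_itv /= andbT; case: (ltP x zeta); [left|right].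
- by apply: measurableI => //; exact: measurable_itv.
- by apply: measurableI => //; exact: measurable_itv.
apply/seteqP; split=> // x [[_ h1] [_ h2]]; move: h1 h2.
by rewrite /= !in_itv /= andbT => ?; rewrite leNgt => /negP.
Qed.

Lemma phase_measure_box (a b : R) (s : 'Z_N) : 0 <= a -> a <= b -> b <= 1 ->
  Lam (`[a, b[%classic `*` [set s]) = (b - a)%:E.
Proof.
move=> a0 ab b1; rewrite phase_measureE (bigD1 s) //= big1 ?adde0 => [|t ts].
  rewrite (_ : _ `&` _ = `[a, b[%classic); last first.
    apply/seteqP; split=> x.
      by rewrite ysectionE /= => -[_ []].
    move=> hx; split; last by rewrite ysectionE.
    by move: hx; rewrite /= !in_itv /= => /andP[h1 h2]; apply/andP; split; lra.
  rewrite lebesgue_measure_itv /= lte_fin.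
  by case: ltP => ba; rewrite ?EFinB // (_ : b = a) ?subee //; lra.
rewrite (_ : _ `&` _ = set0) ?measure0 //.
by apply/seteqP; split=> // x; rewrite ysectionE /= => -[_ [_ e]]; rewrite e eqxx in ts.
Qed.

Lemma phase_measureX (A : set P) : measurable A -> Lam (A `&` X) = Lam A.
Proof.
move=> mA; rewrite !phase_measureE; apply: eq_bigr => s _; congr lebesgue_measure.
apply/seteqP; split=> x.
  by rewrite !ysectionE /= => -[hx []].
by rewrite !ysectionE /= => -[hx Ax].
Qed.

Lemma phase_measure_total : Lam setT = (Zp_trunc N).+2%:R%:E.
Proof.
rewrite phase_measureE (eq_bigr (fun=> 1%E)) => [|s _].
  by rewrite sumr_const card_ord; elim: (Zp_trunc N).+2 => // n IH; rewrite mulrS IH -EFinD -natr1 addrC.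
rewrite (_ : _ `&` _ = U01 R).
  by rewrite lebesgue_measure_itv /= lte_fin ltr01 oppr0 adde0.
by apply/seteqP; split=> x; rewrite ysectionE /=; [case|].
Qed.

End skew.

(** * Real-valued finite measures *)

Section finite_measure.
Variables (d : measure_display) (V : measurableType d) (R : realType).
Variable m : {measure set V -> \bar R}.
Hypothesis m_fin : (m setT < +oo)%E.

Definition rmeas (A : set V) : R := fine (m A).

Lemma rmeasE A : measurable A -> m A = (rmeas A)%:E.
Proof.
move=> mA; rewrite fineK // ge0_fin_numE //.
by apply: le_lt_trans m_fin; apply: le_measure; rewrite ?inE.
Qed.

Lemma rmeas_ge0 A : 0 <= rmeas A.
Proof. exact: fine_ge0. Qed.

Lemma rmeas_le A B : measurable A -> measurable B -> A `<=` B ->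
  rmeas A <= rmeas B.
Proof.
move=> mA mB AB; rewrite -lee_fin -!rmeasE //.
by apply: le_measure; rewrite ?inE.
Qed.

Lemma rmeasU_le A B C : measurable A -> measurable B -> measurable C ->
  A `<=` B `|` C -> rmeas A <= rmeas B + rmeas C.
Proof.
move=> mA mB mC ABC; rewrite -lee_fin EFinD -!rmeasE //.
apply: le_trans (measureU2 _ mB mC); apply: le_measure; rewrite ?inE //.
exact: measurableU.
Qed.

Lemma rmeas_sum_le n (F : 'I_n -> set V) B :
  (forall i, measurable (F i)) -> measurable B ->
  trivIset setT F -> (forall i, F i `<=` B) ->
  \sum_(i < n) rmeas (F i) <= rmeas B.
Proof.
move=> mF mB tF FB; rewrite -lee_fin -sumEFin -rmeasE //.
under eq_bigr do rewrite -rmeasE //.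
rewrite -(measure_bigsetU_ord m xpredT mF tF).
apply: le_measure; rewrite ?inE //; first exact: bigsetU_measurable.
by move=> x /mem_bigsetU [i /FB].
Qed.

Lemma rmeas_bigsetU n (F : 'I_n -> set V) : (forall i, measurable (F i)) ->
  trivIset setT F ->
  rmeas (\big[setU/set0]_(i < n) F i) = \sum_(i < n) rmeas (F i).
Proof.
move=> mF tF; apply: EFin_inj; rewrite -sumEFin -rmeasE //; last first.
  exact: bigsetU_measurable.
rewrite (measure_bigsetU_ord m xpredT mF tF).
by apply: eq_bigr => i _; rewrite -rmeasE.
Qed.

Lemma rmeas_splitC A B : measurable A -> measurable B ->
  rmeas B = rmeas (A `&` B) + rmeas (~` A `&` B).
Proof.
move=> mA mB; have mC := measurableC mA.
apply: EFin_inj; rewrite EFinD -!rmeasE //; try exact: measurableI.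
rewrite -measureU; try exact: measurableI.
  by rewrite -setIUl setUv setTI.
by rewrite setIACA setICr set0I.
Qed.

End finite_measure.

(** * Towers over flat boxes *)

Section towers.
Variables (R : realType) (N : nat) (T lft rgt : R -> R) (zeta : R) (a1 a2 : int).
Hypothesis HT : cellwise_translation T lft rgt.
Hypothesis T_inj : forall x y, unit01 x -> unit01 y -> T x = T y -> x = y.

Notation P := (R * 'Z_N)%type.
Notation S := (skew T (@two_step R N zeta a1 a2)).
Notation X := (@phase_space R N).
Notation lo' := (lo T (cut_lft lft zeta)).
Notation hi' := (hi T (cut_rgt rgt zeta)).

Definition shiftp (p : P) (x : R) : P := (p.1 + x, p.2).
Definition box (p : P) (t : R) : set P := `[p.1, p.1 + t[%classic `*` [set p.2].

(** The boxes over the cylinders of the refined partition are flat. Unlike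
    them, flat boxes can be cut to a prescribed length and glued together. *)
Definition flat n (p : P) (t : R) := [/\ X p, p.1 + t <= 1 &
  forall x i, 0 <= x < t -> (i <= n)%N ->
    iter i S (shiftp p x) = shiftp (iter i S p) x].

Lemma boxP p t q : box p t q <-> exists2 x, 0 <= x < t & q = shiftp p x.
Proof.
case: p q => [p s] [q s']; rewrite /box /shiftp /= in_itv /=; split.
  by move=> [h ->]; exists (q - p); [lra|congr pair; ring].
by move=> [x hx [-> ->]]; split=> //; lra.
Qed.

Lemma measurable_box p t : measurable (box p t).
Proof. by apply: measurableX; [exact: measurable_itv|]. Qed.

Lemma iter_skew1 i p : (iter i S p).1 = iter i T p.1.
Proof. by elim: i => //= i ->. Qed.

Lemma iter_skew_map i p : X p -> X (iter i S p).
Proof. by move=> Xp; elim: i => //= i; apply: (skew_map _ _ _ (cell_map HT)). Qed.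

Lemma flat_mem n p t x : flat n p t -> 0 <= x < t -> X (shiftp p x).
Proof.
move=> [/phase_spaceE /andP[h1 h2] h3 _] /andP[h4 h5].
by apply/phase_spaceE; apply/andP; split; rewrite /=; lra.
Qed.

Lemma flatS n m p t : (m <= n)%N -> flat n p t -> flat m p t.
Proof. by move=> mn [h1 h2 h3]; split=> // x i hx im; apply: h3 => //; exact: leq_trans mn. Qed.

Lemma flat_sub n p t : flat n p t -> box p t `<=` X.
Proof. by move=> fp q /boxP[x hx ->]; exact: flat_mem fp hx. Qed.

Lemma flat_image n p t i : flat n p t -> (i <= n)%N -> 
  box (iter i S p) t `<=` X.
Proof.
move=> fp hi q /boxP[x hx ->]; case: (fp) => _ _ <- //.
by apply: iter_skew_map; exact: flat_mem fp hx.
Qed.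

Lemma flat_step n p t i : flat n p t -> (i < n)%N ->
  X `&` S @^-1` box (iter i.+1 S p) t = box (iter i S p) t.
Proof.
move=> fp hi; case: (fp) => _ _ tr; apply/seteqP; split=> q.
  move=> [Xq /boxP[x hx e]]; apply/boxP; exists x => //.
  rewrite -(tr x i.+1 hx hi) /= (tr x i hx (ltnW hi)) in e.
  apply: (skew_inj T_inj Xq _ e).
  by rewrite -(tr x i hx (ltnW hi)); apply: iter_skew_map; exact: flat_mem fp hx.
move=> /boxP[x hx ->]; split.
  by rewrite -(tr x i hx (ltnW hi)); apply: iter_skew_map; exact: flat_mem fp hx.
by apply/boxP; exists x => //; rewrite -(tr x i.+1 hx hi) /= (tr x i hx (ltnW hi)).
Qed.

Lemma flat_tower (w : set P -> R) n p t i :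
  (forall B, measurable B -> w (X `&` S @^-1` B) = w B) ->
  flat n p t -> (i <= n)%N -> w (box (iter i S p) t) = w (box p t).
Proof.
move=> winv fp; elim: i => // i IH hi; rewrite -IH; last exact: ltnW.
by rewrite -(flat_step fp hi) winv //; exact: measurable_box.
Qed.

(** Images that met would contain a point returning at a distance below [t]. *)
Lemma tower_trivIset n p (t : R) : X p ->
  (forall m x, (0 < m < n)%N -> unit01 x -> t <= `|iter m T x - x|) ->
  trivIset setT (fun i : 'I_n => box (iter i S p) t).
Proof.
move=> Xp far; apply/trivIsetP => /= i j _ _.
wlog ij : i j / (i < j)%N => [H ij|_].
  have [h|h|/val_inj e] := ltngtP i j; first exact: H.
    by rewrite setIC; apply: H => //; rewrite eq_sym.
  by rewrite e eqxx in ij.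
apply/seteqP; split=> // q [/boxP[x hx ->] /boxP[y hy e]].
have e1 := congr1 fst e; rewrite /= !iter_skew1 in e1.
have h : (0 < j - i < n)%N.
  by rewrite subn_gt0 ij (leq_ltn_trans (leq_subr _ _)).
have u1 : unit01 (iter i T p.1) by apply: (iter_unit01 HT); apply/phase_spaceE.
have := far _ _ h u1; rewrite -iterD subnK 1?ltnW //.
rewrite -[X in t <= `|X|]/(iter j T p.1 - iter i T p.1).
by rewrite leNgt ltr_norml => /negP[]; apply/andP; split; lra.
Qed.

Let HT' := cut_cellwise_translation zeta HT.

Lemma cut_lft_eq x y : unit01 x -> unit01 y ->
  cut_lft lft zeta x = cut_lft lft zeta y -> (x < zeta) = (y < zeta).
Proof.
have h x' : unit01 x' -> (x' < zeta) = (cut_lft lft zeta x' < zeta).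
  move=> hx; have /andP[h1 _] := cell_mem HT' hx.
  move: h1; rewrite /cut_lft; case: (leP zeta x') => [_|h2 h1].
    by rewrite gt_max ltxx andbF.
  by rewrite (le_lt_trans h1).
by move=> hx hy e; rewrite h // e -h.
Qed.

(** On a cell of the refined partition [T] is a translation and the cocycle is
    constant. *)
Lemma cyl_flat n (x u t : R) (s : 'Z_N) : unit01 x -> 0 < t -> lo' n x <= u -> u + t <= hi' n x ->
  flat n (u, s) t.
Proof.
move=> hx t0 h1 h2.
have [l0 h3] := cyl_sub HT' n hx.
have in_cyl y : 0 <= y < t -> lo' n x <= u + y < hi' n x by move=> ?; lra.
have un y : 0 <= y < t -> unit01 (u + y) by move=> /in_cyl; exact: (cyl_unit01 HT' hx).
have z0 : 0 <= (0 : R) < t by rewrite lexx.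
have uu : unit01 u by have := un 0 z0; rewrite addr0.
split; [exact/phase_spaceE|by rewrite /=; lra|].
move=> y i hy; rewrite /shiftp /=; elim: i => // i IH hi.
rewrite /= IH; last exact: ltnW.
have tr j : (j <= n)%N -> iter j T (u + y) = iter j T u + y.
  move=> hj; have e0 := cyl_iter HT' hx (in_cyl 0 z0) hj.
  rewrite addr0 in e0.
  by rewrite (cyl_iter HT' hx (in_cyl y hy) hj) e0; ring.
have e : (iter i T u + y < zeta) = (iter i T u < zeta).
  apply: cut_lft_eq.
  - by rewrite -tr; [exact/(iter_unit01 HT)/un|exact: ltnW].
  - exact: (iter_unit01 HT).
  rewrite -tr; last exact: ltnW.
  rewrite -(cyl_same_code HT' hx (in_cyl y hy) hi).
  by have := cyl_same_code HT' hx (in_cyl 0 z0) hi; rewrite addr0.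
rewrite /skew /= !iter_skew1 /= /two_step e; congr pair.
by rewrite -tr; [rewrite -iterS tr|exact: ltnW].
Qed.

End towers.

(** * Absolute continuity of the invariant measures *)

Section good_times.
Variables (R : realType) (N : nat) (T lft rgt : R -> R) (zeta : R) (a1 a2 : int).
Hypothesis HT : cellwise_translation T lft rgt.
Hypothesis T_inj : forall x y, unit01 x -> unit01 y -> T x = T y -> x = y.

Notation P := (R * 'Z_N)%type.
Notation S := (skew T (@two_step R N zeta a1 a2)).
Notation X := (@phase_space R N).
Notation lo' := (lo T (cut_lft lft zeta)).
Notation hi' := (hi T (cut_rgt rgt zeta)).
Notation flat := (flat T zeta a1 a2).
Let HT' := cut_cellwise_translation zeta HT.

(** Long cylinders allow covers by few flat boxes, and far returns make the
    images of these boxes disjoint. The order [n + 1] and the factor [2] leave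
    room for the union of the image of a flat box with an overlapping flat box,
    which is flat for one step less and up to twice as long. *)
Definition good n (l : R) := [/\ 0 < l,
  forall x, unit01 x -> l <= hi' n.+1 x - lo' n.+1 x &
  forall m x, (0 < m <= n)%N -> unit01 x -> 2 * l <= `|iter m T x - x|].

Lemma shiftpA (p : P) x y : shiftp (shiftp p x) y = shiftp p (x + y).
Proof. by rewrite /shiftp /= addrA. Qed.

Lemma boxU (p : P) a b : 0 <= a -> 0 <= b ->
  box p (a + b) = box p a `|` box (shiftp p a) b.
Proof.
move=> a0 b0; apply/seteqP; split=> q.
  move=> /boxP[x hx ->]; have [xa|ax] := ltP x a; [left|right]; apply/boxP.
    by exists x => //; lra.
  by exists (x - a); [lra|rewrite shiftpA; congr shiftp; ring].
case=> /boxP[x hx ->]; apply/boxP; first by exists x => //; lra.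
by rewrite shiftpA; exists (a + x) => //; lra.
Qed.

Lemma box0 (p : P) : box p 0 = set0.
Proof. by apply/seteqP; split=> // q /boxP[x hx _]; lra. Qed.

(** At a good time an interval of length at most [l] meets at most two
    cylinders, hence the factor [2]. *)
Lemma cover_bound (w : set P -> R) n l kappa k (p : P) t :
  w set0 = 0 ->
  (forall q a b, 0 <= a -> 0 <= b ->
     w (box q (a + b)) <= w (box q a) + w (box (shiftp q a) b)) ->
  0 <= kappa -> good n l ->
  (forall x u s t, unit01 x -> 0 < t <= l -> lo' n.+1 x <= u -> u + t <= hi' n.+1 x ->
     w (box (u, s) t) <= kappa) ->
  0 <= p.1 -> 0 <= t <= k%:R * l -> p.1 + t <= 1 ->
  w (box p t) <= 2 * kappa * k%:R.
Proof.
move=> w0 wU k0 [l0 long _] wflat.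
have cell q b : 0 <= q.1 -> 0 <= b <= l -> q.1 + b <= 1 -> w (box q b) <= 2 * kappa.
  case: q => [u s] /= u0 bl ub.
  have [b0|b0] := eqVneq b 0; first by rewrite b0 box0 w0; lra.
  have bgt0 : 0 < b by rewrite lt_neqAle eq_sym b0; case/andP: bl.
  have uu : unit01 u by apply/andP; split; lra.
  have /andP[h1 h2] := cyl_mem HT' n.+1 uu.
  have [h3|h3] := leP (u + b) (hi' n.+1 u).
    by apply: (@le_trans _ _ kappa); [apply: (wflat u) => //; lra|lra].
  set h := hi' n.+1 u in h2 h3.
  have uh : unit01 h by apply/andP; split; lra.
  have /andP[h4 h5] := cyl_mem HT' n.+1 uh.
  (* [h] is an end of a cylinder on its left, so it also is one on its right *)
  have eh : lo' n.+1 h = h.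
    apply/eqP; rewrite eq_le h4 leNgt; apply/negP => h6.
    pose z := Num.max (lo' n.+1 h) u.
    have zh : z < h by rewrite gt_max h6.
    have zu : u <= z by rewrite le_max lexx orbT.
    have zl : lo' n.+1 h <= z by rewrite le_max lexx.
    have z1 : lo' n.+1 h <= z < hi' n.+1 h by apply/andP; split; lra.
    have z2 : lo' n.+1 u <= z < hi' n.+1 u by rewrite -/h; apply/andP; split; lra.
    have [_ e1] := cyl_eq HT' uh z1; have [_ e2] := cyl_eq HT' uu z2.
    by move: h5; rewrite -e1 e2 -/h ltxx.
  have lh := long _ uh; rewrite eh in lh.
  have -> : b = (h - u) + (b - (h - u)) by ring.
  apply: (le_trans (wU _ _ _ _ _)); try lra.
  have e : u + (h - u) = h by ring.
  rewrite mulr_natl mulr2n lerD //; first by apply: (wflat u); rewrite ?e -?/h //; lra.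
  by rewrite /shiftp /= e; apply: (wflat h); rewrite ?eh //; lra.
elim: k p t => [|k IH] p t p0 tk pt.
  by rewrite mulr0 (_ : t = 0) ?box0 ?w0 //; lra.
have kk : k.+1%:R = k%:R + 1 :> R by rewrite natr1.
rewrite kk in tk *.
have k0' : (0 : R) <= k%:R by [].
have [tl|tl] := leP t l.
  apply: le_trans (cell _ _ p0 _ pt) _; first by lra.
  by rewrite mulrDr mulr1 lerDr mulr_ge0 // mulr_ge0.
have -> : t = l + (t - l) by ring.
apply: (le_trans (wU _ _ _ _ _)); try lra.
rewrite mulrDr mulr1 addrC lerD //; last by apply: cell => //; lra.
by apply: IH; rewrite /=; lra.
Qed.

Variable delta : R.
Hypothesis delta_gt0 : 0 < delta.
Hypothesis good_often : forall n0, exists2 n, (n0 <= n)%N & (0 < n)%N /\ good n (delta / n%:R).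

Section absolute_continuity.
Variable mu : probability P R.
Hypothesis mu_inv : invariant_probability S mu.

Let mu_fin : (mu setT < +oo)%E.
Proof. by rewrite probability_setT ltry. Qed.

Let w := rmeas mu.

Let w_inv B : measurable B -> w (X `&` S @^-1` B) = w B.
Proof. by move=> mB; have [_ h] := mu_inv; congr fine; exact: h. Qed.

(** The first [n] images of a flat box are disjoint and have the same mass. *)
Lemma flat_mass n p t : (0 < n)%N ->
  (forall m x, (0 < m < n)%N -> unit01 x -> t <= `|iter m T x - x|) ->
  flat n p t -> w (box p t) <= n%:R^-1.
Proof.
move=> n0 far fp; have [Xp _ _] := fp.
have := rmeas_sum_le mu_fin (fun i : 'I_n => measurable_box (iter i S p) t)
  measurableT (tower_trivIset HT Xp far) (fun i => @subsetT _ _).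
rewrite (eq_bigr (fun=> w (box p t))) => [|i _]; last first.
  by apply: (flat_tower HT T_inj w_inv fp); exact: ltnW.
rewrite sumr_const card_ord [X in _ <= X](_ : _ = 1).
  by rewrite -[_ *+ n]mulr_natr -ler_pdivlMr ?ltr0n // div1r.
exact: (congr1 fine (probability_setT mu)).
Qed.

(** Covering the box by flat boxes of a good time [n] overestimates its mass by
    at most [2 / n], which vanishes along the good times. *)
Lemma box_mass p t : 0 <= p.1 -> 0 <= t -> p.1 + t <= 1 ->
  w (box p t) <= 2 / delta * t.
Proof.
move=> p0 t0 pt; apply/ler_addgt0Pr => e e0.
have [n] := good_often (Num.trunc (2 / e)).+1; move=> nn0 [n0 gn].
have [l0 _ far] := gn.
have n0' : (0 : R) < n%:R by rewrite ltr0n.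
have ne : 2 / n%:R <= e.
  rewrite ler_pdivrMr // mulrC -ler_pdivrMr //.
  by apply: le_trans (ltW (truncnS_gt _)) _; rewrite ler_nat.
set l := delta / n%:R in l0 gn far.
have tl : 0 <= t / l by rewrite divr_ge0 // ltW.
pose k := (Num.trunc (t / l)).+1.
have hk : t <= k%:R * l by rewrite -ler_pdivrMr //; apply/ltW/truncnS_gt.
have kle : k%:R <= t / l + 1 by rewrite /k -natr1 lerD2r truncn_le.
have h : w (box p t) <= 2 * n%:R^-1 * k%:R.
  apply: (cover_bound (n := n) (l := l)); rewrite ?t0 //.
  - by rewrite /w /rmeas measure0.
  - move=> q a b a0 b0; rewrite (boxU _ a0 b0).
    apply: (rmeasU_le mu_fin) => //; try exact: measurable_box.
    by apply: measurableU; exact: measurable_box.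
  - move=> x u s t' ux /andP[t'0 t'l] h1 h2; apply: flat_mass => //.
      move=> m y /andP[m0 mn] uy; have := far m y _ uy; rewrite m0 ltnW // => /(_ isT).
      by apply: le_trans; lra.
    exact: (flatS (leqnSn n) (cyl_flat a1 a2 HT s ux t'0 h1 h2)).
apply: (le_trans h); apply: (@le_trans _ _ (2 * n%:R^-1 * (t / l + 1))).
  by rewrite ler_wpM2l // mulr_ge0.
have -> : 2 * n%:R^-1 * (t / l + 1) = 2 / delta * t + 2 / n%:R; last by rewrite lerD2l.
by rewrite /l; field; rewrite ?gt_eqF.
Qed.

Lemma slab_mass (a b : R) s : a < b ->
  w ((`]a, b]%classic `&` U01 R) `*` [set s]) <= 2 / delta * (b - a).
Proof.
move=> ab; have C0 : 0 < 2 / delta by rewrite divr_gt0.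
apply/ler_addgt0Pr => e e0; pose h := e / (2 / delta).
have h0 : 0 < h by rewrite divr_gt0.
pose a' := Num.max a 0; pose b' := Num.min (b + h) 1.
have [ba|ab'] := leP b' a'.
  rewrite (_ : _ `*` _ = set0).
    by rewrite /w /rmeas measure0 /=; apply: addr_ge0; [apply: mulr_ge0; lra|lra].
  apply/seteqP; split=> // -[x s'] [[/=]]; rewrite !in_itv /= => h1 h2 _.
  by move: ba; rewrite /a' /b' leNgt => /negP; apply; rewrite lt_min !gt_max; lra.
apply: (@le_trans _ _ (w (box (a', s) (b' - a')))).
  apply: (rmeas_le mu_fin).
  - by apply: measurableX => //; apply: measurableI; exact: measurable_itv.
  - exact: measurable_box.
  move=> [x s'] [[/=]]; rewrite !in_itv /= => h1 h2 ->; apply/boxP.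
  exists (x - a'); last by rewrite /shiftp /=; congr pair; ring.
  rewrite /a' /b' subr_ge0 ltrD2r ge_max lt_min; lra.
have a'0 : 0 <= a' by rewrite le_max lexx orbT.
have b'1 : b' <= 1 by rewrite ge_min lexx orbT.
have a'a : a <= a' by rewrite le_max lexx.
have b'b : b' <= b + h by rewrite ge_min lexx.
apply: (le_trans (box_mass _ _ _)); rewrite /=; try lra.
have -> : e = 2 / delta * h by rewrite mulrC divfK // gt_eqF.
by rewrite -mulrDr ler_pM2l //; lra.
Qed.

Lemma slab_null (D : set R) s : measurable D -> D `<=` U01 R ->
  lebesgue_measure D = 0%E -> mu (D `*` [set s]) = 0%E.
Proof.
move=> mD DU D0; have C0 : 0 < 2 / delta by rewrite divr_gt0.
apply/eqP; rewrite eq_le measure_ge0 andbT; apply/lee_addgt0Pr => e e0; rewrite add0e.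
have : (lebesgue_measure D < (e / (2 / delta))%:E)%E by rewrite D0 lte_fin divr_gt0.
move=> /ereal_inf_lt[z [/= M [ocM DM] sMz ze]].
pose F k : set R := M k.
have mM k : measurable (F k).
  by apply: sub_sigma_algebra; exact: ocM.
have mMU k : measurable ((F k `&` U01 R) `*` [set s]).
  by apply: measurableX => //; apply: (measurableI _ _ (mM k)); exact: measurable_itv.
have sub : D `*` [set s] `<=` \bigcup_k ((F k `&` U01 R) `*` [set s]).
  move=> [x t] [/= Dx ->]; have [k _ Mx] := DM _ Dx.
  by exists k => //; split=> //; split=> //; exact: DU.
have le1 k : (mu ((F k `&` U01 R) `*` [set s]) <= (2 / delta)%:E * wlength idfun (M k))%E.
  rewrite /F; have /ocitvP[->|[[a b] /= ab ->]] := ocM k.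
    by rewrite set0I set0X measure0 wlength0 mule0.
  rewrite (wlength_itv_bnd _ _ _ (ltW ab)) -EFinM (rmeasE mu_fin).
    by rewrite lee_fin; exact: slab_mass.
  by apply: measurableX => //; apply: measurableI; exact: measurable_itv.
apply: (@le_trans _ _ (\sum_(k <oo) mu ((F k `&` U01 R) `*` [set s]))%E).
  by apply: measure_sigma_subadditive => //; exact: measurableX.
apply: (@le_trans _ _ (\sum_(k <oo) ((2 / delta)%:E * wlength idfun (M k)))%E).
  by apply: lee_nneseries.
rewrite nneseriesZl; last by move=> k _; exact: wlength_ge0.
rewrite sMz; apply: (@le_trans _ _ ((2 / delta)%:E * (e / (2 / delta))%:E)%E).
  by apply: lee_wpmul2l; rewrite ?lee_fin; exact: ltW.
by rewrite -EFinM mulrC divfK // gt_eqF.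
Qed.

Lemma null_mass (E : set P) : measurable E -> @phase_measure R N E = 0%E -> mu E = 0%E.
Proof.
move=> mE E0.
have slice0 s : leb (U01 R `&` ysection E s) = 0%E.
  apply/eqP; rewrite eq_le measure_ge0 andbT -E0 phase_measureE (bigD1 s) //=.
  by apply: leeDl; apply: sume_ge0 => t _; exact: measure_ge0.
have mX := @measurable_phase_space R N.
have -> : E = (E `\` X) `|` \big[setU/set0]_(s : 'Z_N) ((U01 R `&` ysection E s) `*` [set s]).
  apply/seteqP; split=> [[x s] Ex|[x s]].
    have [Xx|nX] := pselect (X (x, s)); [right|by left].
    apply/mem_bigsetU; exists s; split=> //=; split; first by case: Xx.
    by rewrite ysectionE.
  by case=> [[]|/mem_bigsetU[t [/= [_ +] ->]]] //; rewrite ysectionE.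
have mU s : measurable (U01 R `&` ysection E s).
  by apply: measurableI; [exact: measurable_itv|exact: measurable_ysection].
have mslab s : measurable ((U01 R `&` ysection E s) `*` [set s]).
  exact: measurableX.
have tslab : trivIset setT (fun s : 'Z_N => (U01 R `&` ysection E s) `*` [set s]).
  apply/trivIsetP => /= s t _ _ /eqP st; apply/seteqP.
  by split=> // -[x u] [[_ /= e1] [_ /= e2]]; apply: st; rewrite -e1 -e2.
apply/eqP; rewrite eq_le measure_ge0 andbT.
have mUslab : measurable (\big[setU/set0]_(s : 'Z_N) ((U01 R `&` ysection E s) `*` [set s])).
  exact: bigsetU_measurable.
apply: (le_trans (measureU2 _ (measurableD mE mX) mUslab)).
rewrite (measure_bigsetU_ord mu xpredT mslab tslab) big1 ?adde0 => [|s _]; last first.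
  by apply: slab_null => //; exact: slice0.
have [X1 _] := mu_inv.
apply: (@le_trans _ _ (mu (~` X))).
  by apply: le_measure; rewrite ?inE; [exact: measurableD|exact: measurableC|move=> x []].
by rewrite probability_setC // X1 subee.
Qed.

End absolute_continuity.
End good_times.

(** * Ergodicity of Lebesgue measure *)

Lemma compact_gap (R : realType) (K1 K2 : set R) : compact K1 -> compact K2 ->
  K1 `&` K2 = set0 ->
  exists2 e : R, 0 < e & forall x y, K1 x -> K2 y -> e <= `|x - y|.
Proof.
move=> c1 c2 d12; pose g (p : R * R) : R := p.1 - p.2.
have cg : continuous g.
  by move=> p; apply: cvgB; [exact: cvg_fst|exact: cvg_snd].
have := continuous_compact (continuous_subspaceT cg) (compact_setX c1 c2).
move=> /(compact_closed (@norm_hausdorff _ R)) cl.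
have n0 : (~` (g @` (K1 `*` K2))) 0.
  move=> [[x y] [/= K1x K2y]] /eqP; rewrite /g /= subr_eq0 => /eqP xy.
  have : (K1 `&` K2) x by split=> //; rewrite xy.
  by rewrite d12.
have [e e0 he] : exists2 e : R, 0 < e & ball (0 : R) e `<=` ~` (g @` (K1 `*` K2)).
  by apply/nbhs_ballP; apply: open_nbhs_nbhs; split=> //; exact: closed_openC.
exists e => // x y Kx Ky; rewrite leNgt; apply/negP => h.
have /he : ball (0 : R) e (x - y) by rewrite /ball /= sub0r normrN.
by apply; exists (x, y).
Qed.

Section separation.
Variables (R : realType) (N : nat).
Notation P := (R * 'Z_N)%type.
Notation X := (@phase_space R N).
Notation Lam := (@phase_measure R N).

Let Lam_fin : (Lam setT < +oo)%E.
Proof. by rewrite phase_measure_total ltry. Qed.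

(** Inner regularity provides compact sets inside the set and inside its
    complement that leave out a small measure. They are a positive distance
    apart, and a box shorter than this distance cannot meet both. *)
Lemma separation (A : set P) (eps : R) : measurable A -> 0 < eps ->
  exists2 d, 0 < d & exists E, [/\ measurable E, rmeas Lam E <= eps &
    forall p t, box p t `<=` X -> t < d ->
      A `&` box p t `<=` E \/ ~` A `&` box p t `<=` E].
Proof.
move=> mA eps0; pose eps' := eps / (2 * (Zp_trunc N).+2%:R).
have eps'0 : 0 < eps' by rewrite divr_gt0 // mulr_gt0 // ltr0n.
have inner (D : set R) : measurable D -> exists K, [/\ compact K, K `<=` U01 R `&` D &
    (leb ((U01 R `&` D) `\` K) < eps'%:E)%E].
  move=> mD; apply: lebesgue_regularity_inner => //.
    by apply: measurableI => //; exact: measurable_itv.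
  apply: (@le_lt_trans _ _ (leb (U01 R))).
    by apply: le_measure; rewrite ?inE //; apply: measurableI => //; exact: measurable_itv.
  by rewrite /leb lebesgue_measure_itv /= lte_fin ltr01 oppr0 adde0 ltry.
have [K1 hK1] := choice (fun s => inner _ (measurable_ysection s mA)).
have [K2 hK2] := choice (fun s => inner _ (measurable_ysection s (measurableC mA))).
have gaps s : exists e : R, 0 < e /\ forall x y, K1 s x -> K2 s y -> e <= `|x - y|.
  have [c1 s1 _] := hK1 s; have [c2 s2 _] := hK2 s.
  have [|e e0 he] := compact_gap c1 c2; last by exists e.
  apply/seteqP; split=> // x [/s1 [_ +] /s2 [_]].
  by rewrite !ysectionE.
have [e he] := choice gaps.
exists (\big[Num.min/1]_(s : 'Z_N) e s).
  by apply/lt_bigmin => // s _; have [] := he s.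
pose E : set P := [set p | U01 R p.1 /\ ~ K1 p.2 p.1 /\ ~ K2 p.2 p.1].
have mK (K : set R) : compact K -> measurable K by exact: compact_measurable.
have sliceE s : ysection E s = (U01 R `\` K1 s) `\` K2 s.
  by apply/seteqP; split=> x; rewrite ysectionE /E /=; [move=> [? []]|move=> [[]]].
have mE : measurable E.
  apply: measurable_slices => s; rewrite sliceE.
  have [c1 _ _] := hK1 s; have [c2 _ _] := hK2 s.
  by apply: measurableD; [apply: measurableD; [exact: measurable_itv|exact: mK]|exact: mK].
exists E; split=> //.
  rewrite -lee_fin -rmeasE // phase_measureE.
  apply: (@le_trans _ _ (\sum_(s : 'Z_N) (2 * eps')%:E)%E).
    apply: lee_sum => s _.
    have [c1 s1 h1] := hK1 s; have [c2 s2 h2] := hK2 s.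
    have m1 : measurable ((U01 R `&` ysection A s) `\` K1 s).
      apply: measurableD; last exact: mK.
      by apply: measurableI; [exact: measurable_itv|exact: measurable_ysection].
    have m2 : measurable ((U01 R `&` ysection (~` A) s) `\` K2 s).
      apply: measurableD; last exact: mK.
      apply: measurableI; [exact: measurable_itv|apply: measurable_ysection].
      exact: measurableC.
    rewrite mulr_natl mulr2n EFinD; apply: le_trans (leeD (ltW h1) (ltW h2)).
    apply: le_trans (measureU2 _ m1 m2); apply: le_measure; rewrite ?inE.
    - apply: measurableI; first exact: measurable_itv.
      exact: measurable_ysection.
    - exact: measurableU.
    move=> x [Ux]; rewrite sliceE => -[[_ n1] n2].
    have [Ax|nAx] := pselect (A (x, s)); [left|right]; split=> //; split=> //;
      by rewrite ysectionE.
  rewrite sumEFin lee_fin sumr_const card_ord -[_ *+ _]mulr_natr /eps'.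
  have : ((Zp_trunc N).+2%:R : R) != 0 by rewrite pnatr_eq0.
  move: (_.+2%:R : R) => k k0.
  by rewrite le_eqVlt; apply/orP; left; apply/eqP; field.
move=> p t bX td.
have te : t < e p.2 by apply: lt_le_trans td _; exact: bigmin_le.
have [_ he'] := he p.2.
have [meet|miss] := pselect (exists2 x, `[p.1, p.1 + t[%classic x & K1 p.2 x).
  right=> q [nAq bq]; have Xq := bX q bq; case: q bq nAq Xq => [y s] [/= hy ->] nA Xq.
  split; [by case: Xq|split=> /=].
    have [_ s1 _] := hK1 p.2; move=> /s1 [_]; by rewrite ysectionE.
  move=> Ky; case: meet => x hx Kx; have := he' _ _ Kx Ky.
  rewrite leNgt ltr_norml => /negP[]; move: hx hy; rewrite /= !in_itv /=; lra.
left=> q [Aq bq]; have Xq := bX q bq; case: q bq Aq Xq => [y s] [/= hy ->] nA Xq.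
split; [by case: Xq|split=> /=]; first by move=> Ky; apply: miss; exists y.
have [_ s2 _] := hK2 p.2; move=> /s2 [_]; by rewrite ysectionE.
Qed.
End separation.

Section ergodicity.
Variables (R : realType) (N : nat) (T lft rgt : R -> R) (zeta : R) (a1 a2 : int).
Hypothesis HT : cellwise_translation T lft rgt.
Hypothesis T_inj : forall x y, unit01 x -> unit01 y -> T x = T y -> x = y.
Hypothesis T_preserving : forall E : set R, measurable E ->
  measurable (U01 R `&` T @^-1` E) /\
  lebesgue_measure (U01 R `&` T @^-1` E) = lebesgue_measure (U01 R `&` E).

Notation P := (R * 'Z_N)%type.
Notation S := (skew T (@two_step R N zeta a1 a2)).
Notation X := (@phase_space R N).
Notation lo' := (lo T (cut_lft lft zeta)).
Notation hi' := (hi T (cut_rgt rgt zeta)).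
Notation flat := (@flat R N T zeta a1 a2).
Notation good := (good T lft rgt zeta).
Notation Lam := (@phase_measure R N).
Let HT' := cut_cellwise_translation zeta HT.

Variable delta : R.
Hypothesis delta_gt0 : 0 < delta.
Hypothesis good_often : forall n0, exists2 n, (n0 <= n)%N & (0 < n)%N /\ good n (delta / n%:R).
Hypothesis S_min : minimal S.

Let Lam_fin : (Lam setT < +oo)%E.
Proof. by rewrite phase_measure_total ltry. Qed.

Lemma shiftp0 (p : P) : shiftp p 0 = p.
Proof. by case: p => x s; rewrite /shiftp addr0. Qed.

Lemma sub_box (p : P) a s t : 0 <= a -> a + s <= t -> box (shiftp p a) s `<=` box p t.
Proof.
move=> a0 ast q /boxP[x hx ->]; apply/boxP; exists (a + x); first lra.
by rewrite shiftpA.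
Qed.

Lemma flat_next n p t : flat n.+1 p t -> flat n (S p) t.
Proof.
move=> fp; have [Xp _ tr] := fp; have XS := skew_map zeta a1 a2 (cell_map HT) Xp.
split=> // [|x i hx hi]; last first.
  by rewrite -iterSr -(tr x i.+1 hx hi) iterSr; have /= -> := tr x 1%N hx isT.
rewrite leNgt; apply/negP => h.
have /phase_spaceE /andP[_ S1] := XS.
have hb : box (S p) t (shiftp (S p) (1 - (S p).1)).
  by apply/boxP; exists (1 - (S p).1) => //; lra.
have /phase_spaceE := flat_image HT fp (isT : (1 <= n.+1)%N) hb.
by rewrite /unit01 /=; lra.
Qed.

Lemma flat_union n p a l : 0 <= a < l -> flat n p l -> flat n (shiftp p a) l ->
  flat n p (a + l).
Proof.
move=> hal [Xp _ tr1] [_ h2 tr2]; split=> // [|x i hx hi].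
  by move: h2; rewrite /= addrA.
have [xl|lx] := ltP x l; first by apply: tr1 => //; lra.
have -> : shiftp p x = shiftp (shiftp p a) (x - a).
  by rewrite shiftpA; congr shiftp; ring.
by rewrite tr2 ?tr1 // ?shiftpA; [congr shiftp; ring|lra].
Qed.

(** Flat boxes around consecutive points of an orbit are not images of one
    another, but one flat box contains the image of the first and the second, and
    it serves to compare them. *)
Lemma flat_hull n p q l y : flat n.+1 p l -> flat n.+1 q l ->
  box p l y -> box q l (S y) ->
  exists h t, [/\ flat n h t, t <= 2 * l,
    box (S p) l `<=` box h t & box q l `<=` box h t].
Proof.
move=> fp fq /boxP[x hx ey] /boxP[z hz eS].
have [_ _ tr] := fp; have /= e1 := tr x 1%N hx isT.
rewrite ey e1 in eS.
have f1 := flat_next fp; have f2 := flatS (leqnSn n) fq.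
have es : (S p).2 = q.2 := congr1 snd eS.
have ep : (S p).1 + x = q.1 + z := congr1 fst eS.
have [le|le] := leP (S p).1 q.1.
  have eq : q = shiftp (S p) (q.1 - (S p).1).
    by rewrite /shiftp es; case: (q) => u s /=; congr pair; ring.
  have al : 0 <= q.1 - (S p).1 < l by lra.
  exists (S p), (q.1 - (S p).1 + l); split.
  - by apply: flat_union => //; rewrite -eq.
  - lra.
  - by rewrite -[X in box X l]shiftp0; apply: sub_box; lra.
  - by rewrite {1}eq; apply: sub_box; lra.
have eq : S p = shiftp q ((S p).1 - q.1).
  by rewrite /shiftp -es; case: (S p) => u s /=; congr pair; ring.
have al : 0 <= (S p).1 - q.1 < l by lra.
exists q, ((S p).1 - q.1 + l); split.
- by apply: flat_union => //; rewrite -eq.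
- lra.
- by rewrite {1}eq; apply: sub_box; lra.
- by rewrite -[X in box X l]shiftp0; apply: sub_box; lra.
Qed.

Lemma flat_around n l u t x s : good n l -> unit01 x ->
  0 < t <= l -> lo' n.+1 x <= u -> u + t <= hi' n.+1 x ->
  exists2 p, flat n.+1 p l & box (u, s) t `<=` box p l.
Proof.
move=> [l0 long _] ux htl h1 h2; have h3 := long _ ux.
pose v := Num.min u (hi' n.+1 x - l).
have vu : v <= u by rewrite ge_min lexx.
have vl : v + l <= hi' n.+1 x.
  by have : v <= hi' n.+1 x - l; [rewrite ge_min lexx orbT|lra].
have lv : lo' n.+1 x <= v by rewrite le_min h1; lra.
have uv : u + t <= v + l.
  by rewrite /v; case: (leP u (hi' n.+1 x - l)); lra.
exists (v, s); first exact: (cyl_flat a1 a2 HT s ux l0 lv vl).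
have -> : (u, s) = shiftp (v, s) (u - v) by rewrite /shiftp /=; congr pair; ring.
by apply: sub_box; lra.
Qed.

Variable A : set P.
Hypothesis mA : measurable A.
Hypothesis A_inv : X `&` S @^-1` A `<=` A.

Let wA B := rmeas Lam (A `&` B).
Let wC B := rmeas Lam (~` A `&` B).
Let mC := measurableC mA.
Let mS B : measurable B -> measurable (X `&` S @^-1` B).
Proof. exact: (measurable_skew _ _ _ T_preserving). Qed.

Let Lam_inv B : measurable B -> rmeas Lam (X `&` S @^-1` B) = rmeas Lam B.
Proof. by move=> mB; rewrite /rmeas phase_measure_skew. Qed.

Let wA_inv B : measurable B -> wA (X `&` S @^-1` B) = wA B.
Proof.
move=> mB; rewrite /wA; have mAB := measurableI _ _ mA mB.
have mX := @measurable_phase_space R N.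
rewrite -[in RHS]Lam_inv //; apply/eqP; rewrite eq_le; apply/andP; split; last first.
  apply: (rmeas_le Lam_fin); [exact: mS|by apply: measurableI => //; exact: mS|].
  by move=> q [Xq [Aq Bq]]; split=> //; exact: A_inv.
(* invariance of the measure makes the difference of [A] and its preimage null *)
have D0 : rmeas Lam (~` (X `&` S @^-1` A) `&` (A `&` X)) = 0.
  have := rmeas_splitC Lam_fin (mS mA) (measurableI _ _ mA mX).
  have -> : X `&` S @^-1` A `&` (A `&` X) = X `&` S @^-1` A.
    apply/seteqP; split=> q; first by case.
    by move=> h; split=> //; split; [exact: A_inv|case: h].
  rewrite Lam_inv //.
  have -> : rmeas Lam (A `&` X) = rmeas Lam A by rewrite /rmeas phase_measureX.
  lra.
rewrite -[X in _ <= X]addr0 -[X in _ <= _ + X]D0.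
apply: (rmeasU_le Lam_fin).
- by apply: measurableI => //; exact: mS.
- exact: mS.
- by apply: measurableI; [apply: measurableC; exact: mS|exact: (measurableI _ _ mA mX)].
move=> q [Aq [Xq Bq]]; have [Sq|nSq] := pselect (A (S q)); first by left.
by right; split=> // -[].
Qed.

Let wC_inv B : measurable B -> wC (X `&` S @^-1` B) = wC B.
Proof.
move=> mB; have := rmeas_splitC Lam_fin mA mB.
have := rmeas_splitC Lam_fin mA (mS mB).
rewrite Lam_inv // -/(wA _) -/(wC _) -/(wA _) -/(wC _) wA_inv //; lra.
Qed.

Let wA_le B C : measurable B -> measurable C -> B `<=` C -> wA B <= wA C.
Proof.
move=> mB mC' BC; apply: (rmeas_le Lam_fin); try exact: measurableI.
exact: setIS.
Qed.

Let wC_le B C : measurable B -> measurable C -> B `<=` C -> wC B <= wC C.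
Proof.
move=> mB mC' BC; apply: (rmeas_le Lam_fin); try exact: measurableI.
exact: setIS.
Qed.

(** The [n] images of a flat box are disjoint and each contains the same shares
    of [A] and of its complement as the box. By separation each image has one of
    its two shares inside a fixed set of small measure, so [n] times the smaller
    share is small. *)
Lemma flat_dichotomy eps : 0 < eps -> exists n0, forall n, (n0 <= n)%N ->
  (0 < n)%N -> good n (delta / n%:R) -> forall p t, t <= 2 * (delta / n%:R) ->
  flat n p t -> n%:R * wA (box p t) <= eps \/ n%:R * wC (box p t) <= eps.
Proof.
move=> eps0; have [d d0 [E [mE Ee sep]]] := separation mA eps0.
exists (Num.trunc (2 * delta / d)).+1 => n nn0 n0 gn p t tl fp.
have n0' : (0 : R) < n%:R by rewrite ltr0n.
have td : t < d.
  apply: (le_lt_trans tl); rewrite mulrA ltr_pdivrMr // [d * _]mulrC -ltr_pdivrMr //.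
  by apply: lt_le_trans (truncnS_gt _) _; rewrite ler_nat.
have [Xp _ _] := fp; have [_ _ far] := gn.
pose v := Num.min (wA (box p t)) (wC (box p t)).
suff : n%:R * v <= eps.
  by rewrite /v; case: (leP (wA (box p t)) (wC (box p t))) => _ ?; [left|right].
apply: le_trans Ee.
have mb i := measurable_box (iter i S p) t.
have mEb i := measurableI _ _ mE (mb i).
apply: (@le_trans _ _ (\sum_(i < n) rmeas Lam (E `&` box (iter i S p) t))); last first.
  apply: (rmeas_sum_le Lam_fin (fun i => mEb i) mE); last by move=> i q [].
  apply: trivIset_setIl; apply: (tower_trivIset HT Xp) => m x /andP[m0 mn] ux.
  by apply: le_trans tl _; apply: far => //; rewrite m0 ltnW.
have -> : n%:R * v = \sum_(i < n) v by rewrite sumr_const card_ord mulr_natl.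
apply: ler_sum => i _.
have hi : (i <= n)%N by exact: ltnW.
have [s1|s1] := sep _ _ (flat_image HT fp hi) td.
  apply: (@le_trans _ _ (wA (box p t))); first by rewrite ge_min lexx.
  rewrite -(flat_tower HT T_inj wA_inv fp hi); apply: (rmeas_le Lam_fin) => //.
    exact: measurableI.
  by move=> q hq; split; [exact: s1|case: hq].
apply: (@le_trans _ _ (wC (box p t))); first by rewrite ge_min lexx orbT.
rewrite -(flat_tower HT T_inj wC_inv fp hi); apply: (rmeas_le Lam_fin) => //.
  exact: measurableI.
by move=> q hq; split; [exact: s1|case: hq].
Qed.

Section types.
Variables (n : nat) (eps l : R).
Hypothesis lE : l = delta / n%:R.
Hypothesis n_gt0 : (0 < n)%N.
Hypothesis n_good : good n l.
Hypothesis eps_small : 2 * eps < delta.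
Hypothesis dichotomy : forall p t, t <= 2 * l -> flat n p t ->
  n%:R * wA (box p t) <= eps \/ n%:R * wC (box p t) <= eps.

Let l_gt0 : 0 < l. Proof. by have [] := n_good. Qed.
Let n_gt0' : (0 : R) < n%:R. Proof. by rewrite ltr0n. Qed.

(** By the dichotomy, a flat box that does not miss [A] is almost contained in
    it. *)
Definition misses p := n%:R * wA (box p l) <= eps.

(** The two shares, multiplied by [n], add up to [delta]. *)
Lemma not_both p : flat n.+1 p l -> misses p -> n%:R * wC (box p l) <= eps -> False.
Proof.
move=> [/phase_spaceE /andP[p0 _] pl _] h1 h2.
have := rmeas_splitC Lam_fin mA (measurable_box p l).
have -> : rmeas Lam (box p l) = l.
  rewrite /rmeas /box phase_measure_box //=; first by ring.
  by rewrite lerDl ltW.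
rewrite -/(wA _) -/(wC _) => e.
have := lerD h1 h2; rewrite -mulrDr -e lE mulrC divfK ?gt_eqF // => h.
by move: eps_small; rewrite mulr_natl mulr2n ltNge h.
Qed.

(** The box of [q] and the image of the box of [p] lie in one flat box, whose
    type both inherit. *)
Lemma misses_step p q y : flat n.+1 p l -> flat n.+1 q l ->
  box p l y -> box q l (S y) -> misses p <-> misses q.
Proof.
move=> fp fq py qy; have [h [t [fh tl ph qh]]] := flat_hull fp fq py qy.
have mb r s : measurable (box r s : set P) := measurable_box r s.
have eA : wA (box (S p) l) = wA (box p l) := flat_tower HT T_inj wA_inv fp (isT : (1 <= n.+1)%N).
have eC : wC (box (S p) l) = wC (box p l) := flat_tower HT T_inj wC_inv fp (isT : (1 <= n.+1)%N).
case: (dichotomy tl fh) => small.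
  by split=> _; apply: le_trans small; rewrite ler_pM2l // -?eA; apply: wA_le.
split=> [/(not_both fp)|/(not_both fq)] []; apply: le_trans small.
  by rewrite ler_pM2l // -eC; apply: wC_le.
by rewrite ler_pM2l //; apply: wC_le.
Qed.

Lemma flat_through y : X y -> exists2 p, flat n.+1 p l & box p l y.
Proof.
case: y => u s /phase_spaceE /= uu; have /andP[h1 h2] := cyl_mem HT' n.+1 uu.
pose t := Num.min l (hi' n.+1 u - u).
have t0 : 0 < t by rewrite lt_min l_gt0 subr_gt0.
have tl : t <= l by rewrite ge_min lexx.
have ut : u + t <= hi' n.+1 u.
  by have : t <= hi' n.+1 u - u; [rewrite ge_min lexx orbT|lra].
have htl : 0 < t <= l by rewrite t0.
have [p fp sub] := flat_around s n_good uu htl h1 ut.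
exists p => //; apply: sub; apply/boxP; exists 0; first by rewrite lexx.
by rewrite shiftp0.
Qed.

Lemma misses_orbit k p q y : flat n.+1 p l -> flat n.+1 q l ->
  box p l y -> box q l (iter k S y) -> misses p <-> misses q.
Proof.
elim: k p y => [|k IH] p y fp fq py qy; have Xy := flat_sub fp py;
  have [r fr ry] := flat_through (skew_map zeta a1 a2 (cell_map HT) Xy).
  by rewrite (misses_step fp fr py ry) -(misses_step fq fr qy ry).
rewrite (misses_step fp fr py ry); apply: (IH r (S y)) => //.
by rewrite -iterSr.
Qed.

(** Sliding along an orbit does not change the type of a box, and by
    minimality every orbit visits all boxes. *)
Lemma misses_all p q : flat n.+1 p l -> flat n.+1 q l -> misses p <-> misses q.
Proof.
move=> fp fq; have [Xp _ _] := fp.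
have [/phase_spaceE /andP[q0 _] q1 _] := fq.
pose c := q.1 + l / 2.
have uc : `[0, 1[%classic c.
  by rewrite /= in_itv /= /c; have := l_gt0; lra.
have [|x [[Xx orb]]] := S_min Xp q.2 uc (B := `]q.1, (q.1 + l)[%classic).
  apply: open_nbhs_nbhs; split; first exact: interval_open.
  by rewrite /= in_itv /= /c; have := l_gt0; lra.
rewrite /= in_itv /= => hx.
have bq : box q l (x, q.2).
  by apply/boxP; exists (x - q.1); [lra|rewrite /shiftp; congr pair; ring].
have bp : box p l p.
  by apply/boxP; exists 0; [rewrite lexx|rewrite shiftp0].
case: orb => k [e|e].
  by apply: (misses_orbit (k := k) fp fq bp); rewrite e.
by apply: iff_sym; apply: (misses_orbit (k := k) fq fp bq); rewrite e.
Qed.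

Let mass_le (w : set P -> R) : (w = wA \/ w = wC) ->
  (forall p, flat n.+1 p l -> n%:R * w (box p l) <= eps) -> 0 <= eps ->
  w setT <= 2 * (Zp_trunc N).+2%:R * (1 / delta + 1) * eps.
Proof.
move=> ww small eps0.
have [B mB wE] : exists2 B, measurable B & w = fun C => rmeas Lam (B `&` C).
  by case: ww => ->; [exists A|exists (~` A)].
have mb p t := measurable_box p t : measurable (box p t : set P).
have mBb p t := measurableI _ _ mB (mb p t).
pose k := (Num.trunc (1 / l)).+1.
have k1 : 1 <= k%:R * l.
  by rewrite -ler_pdivrMr //; apply/ltW/truncnS_gt.
have k2 : k%:R <= n%:R * (1 / delta + 1).
  apply: (@le_trans _ _ (1 / l + 1)).
    by rewrite /k -natr1 lerD2r truncn_le // divr_ge0 // ltW.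
  have -> : 1 / l = n%:R * (1 / delta) by rewrite lE; field; rewrite !gt_eqF.
  by rewrite mulrDr mulr1 lerD2l ler1n.
have level s : w (box (0, s) 1) <= 2 * (eps / n%:R) * k%:R.
  apply: (cover_bound HT (lft := lft) (rgt := rgt) (zeta := zeta) (n := n) (l := l)) => //=.
  - by rewrite wE setI0 /rmeas measure0.
  - move=> q a b a_ge0 b_ge0; rewrite (boxU _ a_ge0 b_ge0) wE.
    apply: (rmeasU_le Lam_fin) => //; last by rewrite setIUr.
    by apply: measurableI => //; apply: measurableU.
  - by rewrite divr_ge0 // ltW.
  - move=> x u s' t ux ht h1 h2.
    have [p fp sub] := flat_around s' n_good ux ht h1 h2.
    rewrite ler_pdivlMr // mulrC; apply: le_trans (small p fp); rewrite ler_pM2l //.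
    by rewrite wE; apply: (rmeas_le Lam_fin) => //; exact: setIS.
  - by rewrite ler01.
have tB : trivIset setT (fun s : 'Z_N => B `&` box (0, s) 1).
  apply/trivIsetP => /= s t _ _ /eqP st; apply/seteqP.
  by split=> // -[x u] [[_ [/= _ e1]] [_ [/= _ e2]]]; apply: st; rewrite -e1 -e2.
have -> : w setT = \sum_(s : 'Z_N) w (box (0, s) 1).
  rewrite wE setIT -(rmeas_bigsetU Lam_fin (F := fun s => B `&` box (0, s) 1)) //.
  rewrite /rmeas -(phase_measureX mB); congr (fine (Lam _)).
  apply/seteqP; split=> [[x s] [Bx [hx _]]|[x s]].
    by apply/mem_bigsetU; exists s; split=> //; split=> //=; rewrite add0r.
  by move=> /mem_bigsetU[t [Bx [/= hx _]]]; split=> //; split=> //; rewrite add0r in hx.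
apply: (@le_trans _ _ (\sum_(s : 'Z_N) (2 * (eps / n%:R) * k%:R))).
  by apply: ler_sum => s _; exact: level.
rewrite sumr_const card_ord -[_ *+ _]mulr_natr.
have -> : 2 * (Zp_trunc N).+2%:R * (1 / delta + 1) * eps =
    2 * (eps / n%:R) * (n%:R * (1 / delta + 1)) * (Zp_trunc N).+2%:R.
  by field; rewrite !gt_eqF.
by rewrite ler_wpM2r // ler_wpM2l // mulr_ge0 // divr_ge0 // ltW.
Qed.

Lemma small_or_full : 0 <= eps ->
  let C := 2 * (Zp_trunc N).+2%:R * (1 / delta + 1) in
  rmeas Lam A <= C * eps \/ rmeas Lam (~` A) <= C * eps.
Proof.
move=> eps0 C.
have [[p fp mp]|none] := pselect (exists2 p, flat n.+1 p l & misses p).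
  left; have := @mass_le wA (or_introl erefl); rewrite /wA setIT; apply=> // q fq.
  exact/(misses_all fp fq).
right; have := @mass_le wC (or_intror erefl); rewrite /wC setIT; apply=> // q fq.
have ll : l <= 2 * l by have := l_gt0; lra.
have [|//] := dichotomy ll (flatS (leqnSn n) fq).
by move=> mq; case: none; exists q.
Qed.
End types.

(** At a good time all flat boxes are of the same type, and as they cover the
    phase space, [A] or its complement has measure at most a constant multiple
    of [eps], for every [eps]. *)
Lemma phase_measure_ergodic : Lam A = 0%E \/ Lam (~` A) = 0%E.
Proof.
suff : rmeas Lam A <= 0 \/ rmeas Lam (~` A) <= 0.
  have z B : measurable B -> rmeas Lam B <= 0 -> Lam B = 0%E.
    move=> mB h; rewrite (rmeasE Lam_fin mB); congr EFin; apply/eqP.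
    by rewrite eq_le h rmeas_ge0.
  by case=> h; [left|right]; exact: z.
pose C := 2 * (Zp_trunc N).+2%:R * (1 / delta + 1).
have C0 : 0 < C.
  by rewrite /C !mulr_gt0 ?ltr0n // addr_gt0 // divr_gt0.
have [|h1] := leP (rmeas Lam A) 0; first by left.
have [|h2] := leP (rmeas Lam (~` A)) 0; first by right.
pose v := Num.min (rmeas Lam A) (rmeas Lam (~` A)).
pose eps := Num.min (delta / 4) (v / (2 * C)).
have v0 : 0 < v by rewrite lt_min h1.
have eps0 : 0 < eps by rewrite lt_min !divr_gt0 // mulr_gt0.
have eps1 : eps <= delta / 4 by rewrite ge_min lexx.
have eps2 : C * eps <= v / 2.
  apply: (@le_trans _ _ (C * (v / (2 * C)))).
    by rewrite ler_pM2l // ge_min lexx orbT.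
  by rewrite le_eqVlt; apply/orP; left; apply/eqP; field; rewrite gt_eqF.
have va : v <= rmeas Lam A by rewrite ge_min lexx.
have vc : v <= rmeas Lam (~` A) by rewrite ge_min lexx orbT.
have [n0 dich] := flat_dichotomy eps0.
have [n nn0 [n_gt0 gn]] := good_often n0.
have small : 2 * eps < delta by have := delta_gt0; lra.
have [] := small_or_full erefl n_gt0 gn small (dich n nn0 n_gt0 gn) (ltW eps0); rewrite -/C; lra.
Qed.

End ergodicity.

(** * Unique ergodicity *)

Section unique_ergodicity.
Variables (R : realType) (N : nat) (T lft rgt : R -> R) (zeta : R) (a1 a2 : int).
Hypothesis HT : cellwise_translation T lft rgt.
Hypothesis T_inj : forall x y, unit01 x -> unit01 y -> T x = T y -> x = y.
Hypothesis T_preserving : forall E : set R, measurable E ->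
  measurable (U01 R `&` T @^-1` E) /\
  lebesgue_measure (U01 R `&` T @^-1` E) = lebesgue_measure (U01 R `&` E).

Notation P := (R * 'Z_N)%type.
Notation S := (skew T (@two_step R N zeta a1 a2)).
Notation X := (@phase_space R N).
Notation good := (good T lft rgt zeta).
Notation Lam := (@phase_measure R N).

Let count_ge0 : 0 <= ((Zp_trunc N).+2%:R^-1 : R). Proof. by rewrite invr_ge0. Qed.

Definition uniform_measure : set P -> \bar R := mscale (NngNum count_ge0) Lam.

HB.instance Definition _ := Measure.on uniform_measure.

Let uniform_measureT : uniform_measure setT = 1%E.
Proof.
by rewrite /uniform_measure /mscale /= phase_measure_total -EFinM mulVf.
Qed.

HB.instance Definition _ :=
  Measure_isProbability.Build _ P R uniform_measure uniform_measureT.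

Lemma uniform_measure_invariant : invariant_probability S uniform_measure.
Proof.
split.
  have <- := uniform_measureT; rewrite /uniform_measure /mscale; congr (_ * _)%E.
  by rewrite -[in RHS](phase_measureX measurableT) setTI.
move=> A mA; rewrite /uniform_measure /mscale; congr (_ * _)%E.
exact: phase_measure_skew.
Qed.

Variable delta : R.
Hypothesis delta_gt0 : 0 < delta.
Hypothesis good_often : forall n0, exists2 n, (n0 <= n)%N & (0 < n)%N /\ good n (delta / n%:R).
Hypothesis S_min : minimal S.

Section two_measures.
Variables mu nu : probability P R.
Hypothesis mu_inv : invariant_probability S mu.
Hypothesis nu_inv : invariant_probability S nu.

Let fin (m : probability P R) : (m setT < +oo)%E.
Proof. by rewrite probability_setT ltry. Qed.

Let sigma B := rmeas mu B - rmeas nu B.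

Let sigma_split A B : measurable A -> measurable B ->
  sigma B = sigma (A `&` B) + sigma (~` A `&` B).
Proof.
move=> mA mB; rewrite /sigma (rmeas_splitC (fin mu) mA mB).
by rewrite (rmeas_splitC (fin nu) mA mB); ring.
Qed.

Let sigma_inv B : measurable B -> sigma (X `&` S @^-1` B) = sigma B.
Proof.
move=> mB; have [_ h1] := mu_inv; have [_ h2] := nu_inv.
by congr (_ - _); congr fine; [exact: h1|exact: h2].
Qed.

Let mX := @measurable_phase_space R N.

Let null_sigma B : measurable B -> Lam B = 0%E -> sigma B = 0.
Proof.
move=> mB B0; rewrite /sigma.
have -> : rmeas mu B = 0.
  exact: (congr1 fine (null_mass HT T_inj delta_gt0 good_often mu_inv mB B0)).
have -> : rmeas nu B = 0.
  exact: (congr1 fine (null_mass HT T_inj delta_gt0 good_often nu_inv mB B0)).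
by rewrite subrr.
Qed.

(** If the two measures differed, the positive part of their difference, together
    with its preimages, would be an invariant set that carries a positive charge
    while the total charge is zero. Then neither this set nor its complement is
    null, against ergodicity. *)
Lemma invariant_eq A : measurable A -> mu A = nu A.
Proof.
move=> mA.
pose chi : {charge set P -> \bar R} :=
  cadd (charge_of_finite_measure mu) (copp (charge_of_finite_measure nu)).
have [Pos [Neg [[mP posP] [mN negN] PN _]]] := Hahn_decomposition chi.
have chiE B : measurable B -> chi B = (sigma B)%:E.
  move=> mB; rewrite /chi /= /cadd /copp /= /charge_of_finite_measure.
  by rewrite /sigma EFinB -(rmeasE (fin mu) mB) -(rmeasE (fin nu) mB).
have pos B : measurable B -> B `<=` Pos -> 0 <= sigma B.
  by move=> mB BP; rewrite -lee_fin -chiE //; exact: posP.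
have neg B : measurable B -> B `<=` ~` Pos -> sigma B <= 0.
  move=> mB BP; rewrite -lee_fin -chiE //; apply: negN => // q Bq.
  have : (Pos `|` Neg) q by rewrite PN.
  by case=> // Pq; have := BP q Bq Pq.
have max B : measurable B -> sigma B <= sigma Pos.
  move=> mB; rewrite (sigma_split mP mB) (sigma_split mB mP) setIC.
  have := neg (~` Pos `&` B) (measurableI _ _ (measurableC mP) mB) (@subIsetl _ _ _).
  have := pos (~` B `&` Pos) (measurableI _ _ (measurableC mB) mP) (@subIsetr _ _ _).
  lra.
have massT (m : probability P R) : rmeas m setT = 1.
  exact: (congr1 fine (probability_setT m)).
have sigmaT : sigma setT = 0 by rewrite /sigma !massT subrr.
suff P0 : sigma Pos <= 0.
  have h B : measurable B -> sigma B <= 0.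
    by move=> mB; apply: le_trans P0; exact: max.
  have := sigma_split mA measurableT; rewrite !setIT sigmaT.
  have := h _ mA; have := h _ (measurableC mA) => h1 h2 h3.
  have : sigma A = 0 by lra.
  rewrite /sigma => /eqP; rewrite subr_eq0 => /eqP e.
  by rewrite (rmeasE (fin mu) mA) (rmeasE (fin nu) mA) e.
rewrite leNgt; apply/negP => P_gt0.
have null_compl (m : probability P R) : invariant_probability S m -> forall B,
    measurable B -> rmeas m (~` X `&` B) = 0.
  move=> [m1 _] B mB; apply/eqP; rewrite eq_le rmeas_ge0 andbT.
  have -> : 0 = rmeas m (~` X).
    have := rmeas_splitC (fin m) mX measurableT; rewrite !setIT massT.
    have -> : rmeas m X = 1 by exact: (congr1 fine m1).
    lra.
  apply: (rmeas_le (fin m)); [|exact: measurableC|exact: subIsetl].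
  by apply: measurableI => //; exact: measurableC.
(* the union of the first preimages of the positive part, which all have the
   maximal charge *)
pose Q := fix Q k := if k is j.+1 then Q j `|` (X `&` S @^-1` Q j) else X `&` Pos.
have mQ k : measurable (Q k).
  elim: k => [|k IH]; first exact: measurableI.
  by apply: measurableU => //; exact: (measurable_skew _ _ _ T_preserving).
have sQ k : sigma (Q k) = sigma Pos.
  elim: k => [|k IH].
    rewrite (sigma_split mX mP) /= -[LHS]addr0; congr (_ + _).
    by rewrite /sigma !null_compl // subrr.
  have mSQ := measurable_skew zeta a1 a2 T_preserving (mQ k).
  rewrite /=; set B := X `&` S @^-1` Q k in mSQ *.
  have mU : measurable (Q k `|` B) by exact: measurableU.
  apply/eqP; rewrite eq_le (max _ mU) /=.
  have sB : sigma B = sigma Pos by rewrite sigma_inv.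
  have := sigma_split (mQ k) mU.
  have -> : Q k `&` (Q k `|` B) = Q k.
    by apply/seteqP; split=> [q []//|q Qq]; split=> //; left.
  have -> : ~` Q k `&` (Q k `|` B) = ~` Q k `&` B.
    by rewrite setIUr setICl set0U.
  have := sigma_split (mQ k) mSQ; have := max _ (measurableI _ _ (mQ k) mSQ).
  rewrite IH sB; lra.
pose Qoo := \bigcup_k Q k.
have mQoo : measurable Qoo by exact: bigcupT_measurable.
have ndQ : nondecreasing_seq Q.
  by apply/nondecreasing_seqP => j; apply/subsetPset => q Qq; left.
have sQoo : sigma Qoo = sigma Pos.
  have cmu := nondecreasing_cvg_mu (mu := mu) mQ mQoo ndQ.
  have cnu := nondecreasing_cvg_mu (mu := nu) mQ mQoo ndQ.
  have e k : mu (Q k) = ((sigma Pos)%:E + nu (Q k))%E.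
    rewrite (rmeasE (fin mu) (mQ k)) (rmeasE (fin nu) (mQ k)) -EFinD -(sQ k).
    by congr EFin; rewrite /sigma; ring.
  have c2 : (fun k => (sigma Pos)%:E + nu (Q k))%E @ \oo --> ((sigma Pos)%:E + nu Qoo)%E.
    by apply: cvgeD => //; exact: cvg_cst.
  have : mu Qoo = ((sigma Pos)%:E + nu Qoo)%E.
    apply: (cvg_unique (@ereal_hausdorff R) cmu).
    by rewrite (_ : mu \o Q = fun k => ((sigma Pos)%:E + nu (Q k))%E) //; apply/funext.
  rewrite (rmeasE (fin mu) mQoo) (rmeasE (fin nu) mQoo) -EFinD => h.
  have e1 : rmeas mu Qoo = sigma Pos + rmeas nu Qoo by exact: EFin_inj.
  by rewrite -[LHS]/(rmeas mu Qoo - rmeas nu Qoo) e1 addrK.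
have Q_inv : X `&` S @^-1` Qoo `<=` Qoo.
  by move=> q [Xq [k _ Qk]]; exists k.+1 => //; right.
have [z|z] := phase_measure_ergodic HT T_inj T_preserving delta_gt0 good_often S_min mQoo Q_inv.
  by move: sQoo P_gt0; rewrite null_sigma // => <-; rewrite ltxx.
have := sigma_split mQoo measurableT; rewrite !setIT sigmaT sQoo.
by rewrite (null_sigma (measurableC mQoo) z); lra.
Qed.
End two_measures.

Lemma skew_uniquely_ergodic : uniquely_ergodic S.
Proof.
split; first by exists uniform_measure; exact: uniform_measure_invariant.
by move=> mu nu mu_inv nu_inv A; exact: invariant_eq.
Qed.
End unique_ergodicity.

(** * Linear recurrence gives good times *)

Section good_times_exist.
Variables (R : realType) (T lft rgt : R -> R) (zeta : R).
Hypothesis HT : cellwise_translation T lft rgt.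
Hypothesis T_onto : forall y, unit01 y -> exists2 x, unit01 x & T x = y.
Hypothesis T_inj : forall x y, unit01 x -> unit01 y -> T x = T y -> x = y.
Hypothesis T_preserving : forall E : set R, measurable E ->
  measurable (U01 R `&` T @^-1` E) /\
  lebesgue_measure (U01 R `&` T @^-1` E) = lebesgue_measure (U01 R `&` E).
Variable kappa : nat.
Hypothesis recurrent : forall n x z, (0 < n)%N -> unit01 x -> unit01 z ->
  exists2 k, (k + n <= kappa * n)%N & same_code T lft n x (iter k T z).

Lemma iter_preserving k (E : set R) : measurable E ->
  measurable (U01 R `&` iter k T @^-1` E) /\
  lebesgue_measure (U01 R `&` iter k T @^-1` E) = lebesgue_measure (U01 R `&` E).
Proof.
move=> mE; elim: k => [|k [IH1 IH2]].
  by split=> //; apply: measurableI => //; exact: measurable_itv.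
have -> : U01 R `&` iter k.+1 T @^-1` E = U01 R `&` T @^-1` (U01 R `&` iter k T @^-1` E).
  apply/seteqP; split=> x [/= hx].
    rewrite -iterS iterSr => Ex; split=> //; split=> //.
    by move: hx; rewrite !in_itv /=; exact: (cell_map HT).
  by move=> [_ Ex]; split=> //=; rewrite -iterS iterSr.
have [m1 e1] := T_preserving IH1; split=> //.
by rewrite e1 setIA setIid.
Qed.

(** Every point visits a given cylinder of order [n] before the time
    [kappa * n], so the cylinder cannot have a measure below [1 / (kappa * n)]. *)
Lemma recurrent_cyl_long n x : (0 < n)%N -> unit01 x ->
  kappa%:R^-1 / n%:R <= hi T rgt n x - lo T lft n x.
Proof.
move=> n0 hx; pose C : set R := `[lo T lft n x, hi T rgt n x[%classic.
have mC : measurable C by exact: measurable_itv.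
have [l0 h1] := cyl_sub HT n hx; have /andP[lx xh] := cyl_mem HT n hx.
have lebC : leb (U01 R `&` C) = (hi T rgt n x - lo T lft n x)%:E.
  rewrite setIidr => [|y].
    by rewrite /leb lebesgue_measure_itv /= lte_fin (le_lt_trans lx xh).
  by rewrite /C /= !in_itv /= => /andP[h2 h3]; apply/andP; split; lra.
have mV k := (iter_preserving k mC).1.
have [k0 k0n _] := recurrent n0 hx hx.
have kn0 : (0 < kappa * n)%N by lia.
have cover : U01 R `<=` \big[setU/set0]_(k < kappa * n) (U01 R `&` iter k T @^-1` C).
  move=> z zU; have uz : unit01 z by move: zU; rewrite /= in_itv.
  have [k kn hs] := recurrent n0 hx uz.
  have klt : (k < kappa * n)%N by lia.
  apply/mem_bigsetU; exists (Ordinal klt); split=> //=.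
  rewrite /C /= in_itv /=; apply: (same_code_cyl HT) => //.
  exact: (iter_unit01 HT).
have : (leb (U01 R) <= \sum_(k < kappa * n) leb (U01 R `&` iter k T @^-1` C))%E.
  have mU : measurable (U01 R) by exact: measurable_itv.
  exact: (@content_subadditive _ _ _ (@leb R) _
    (fun k => U01 R `&` iter k T @^-1` C) _ (fun k _ => mV k) mU cover).
rewrite (eq_bigr (fun=> (hi T rgt n x - lo T lft n x)%:E)) => [|k _]; last first.
  by rewrite -lebC; exact: (iter_preserving k mC).2.
rewrite sumEFin sumr_const card_ord /leb lebesgue_measure_itv /= lte_fin ltr01.
rewrite oppr0 adde0 lee_fin -[_ *+ _]mulr_natr natrM => h.
have kappa0 : (0 : R) < kappa%:R by rewrite ltr0n; move: kn0; rewrite muln_gt0 => /andP[].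
have n0' : (0 : R) < n%:R by rewrite ltr0n.
by rewrite -invfM -div1r ler_pdivrMr ?mulr_gt0.
Qed.

Hypothesis aperiodic : forall m, (0 < m)%N ->
  ~ (forall x, unit01 x -> iter m T x = x).
Hypothesis zeta01 : unit01 zeta.

Lemma good_times : exists2 delta : R, 0 < delta & forall n0, exists2 n,
  (n0 <= n)%N & (0 < n)%N /\ good T lft rgt zeta n (delta / n%:R).
Proof.
have u0 : unit01 (0 : R) by rewrite /unit01 lexx ltr01.
have kappa0 : (0 < kappa)%N by have [k] := recurrent (n := 1) isT u0 u0; lia.
pose c : R := kappa%:R^-1.
have c0 : 0 < c by rewrite invr_gt0 ltr0n.
pose c2 := c / (2 * kappa)%:R.
have c20 : 0 < c2 by rewrite divr_gt0 // ltr0n muln_gt0.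
have far := return_far HT c0 recurrent recurrent_cyl_long aperiodic.
have [d d0 often] := cut_cyl_long_often HT c0 c20 T_onto T_inj recurrent_cyl_long far zeta01.
pose delta := Num.min d (c2 / 2) / 2.
have m0 : 0 < Num.min d (c2 / 2) by rewrite lt_min d0 divr_gt0.
have delta0 : 0 < delta by rewrite divr_gt0.
have dd : 2 * delta <= d by rewrite /delta mulrC divfK // ge_min lexx.
have dc : 2 * (2 * delta) <= c2.
  have : 2 * delta <= c2 / 2 by rewrite /delta mulrC divfK // ge_min lexx orbT.
  lra.
exists delta => // n0; have [[|n] n0n [// _ long]] := often n0.+2.
have n1 : (0 < n)%N by exact: leq_ltn_trans (leq0n n0) n0n.
have n1' : (0 : R) < n%:R by rewrite ltr0n.
exists n; first exact: ltnW.
split=> //; split; first by rewrite divr_gt0.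
  move=> x hx; apply: le_trans (long x hx).
  have n2 : n.+1%:R <= 2 * n%:R :> R by rewrite -natrM ler_nat mul2n -addnn -addn1 leq_add2l.
  rewrite ler_pdivrMr // mulrAC ler_pdivlMr ?ltr0n //.
  have : delta * n.+1%:R <= delta * (2 * n%:R) by rewrite ler_pM2l.
  have : 2 * delta * n%:R <= d * n%:R by rewrite ler_pM2r.
  lra.
move=> m x /andP[m_gt0 mn] hx; apply: le_trans (far m x m_gt0 hx).
apply: (@le_trans _ _ (c2 / n%:R)); last first.
  by rewrite ler_pM2l // lef_pV2 ?posrE ?ltr0n // ler_nat.
by rewrite mulrA ler_pM2r ?invr_gt0 //; lra.
Qed.

End good_times_exist.

(** If [T ^ m] is the identity, all orbits are finite, hence not dense. *)
Lemma minimal_aperiodic (R : realType) (N : nat) (T : R -> R) (f : R -> 'Z_N) m :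
  (0 < m)%N -> minimal (skew T f) -> ~ (forall x, unit01 x -> iter m T x = x).
Proof.
move=> m0 hmin per.
have fst_iter k p : (iter k (skew T f) p).1 = iter k T p.1.
  by elim: k => //= k ->.
have u0 : unit01 (0 : R) by rewrite /unit01 lexx ltr01.
pose F := [set iter i T 0 | i in `I_m].
have finF : finite_set F by apply: finite_image; exact: finite_II.
have mult j x : unit01 x -> iter (j * m) T x = x.
  by move=> hx; elim: j => // j IH; rewrite mulSn iterD IH per.
have sub : [set x | orbit_of (skew T f) (0, 0) (x, 0)] `<=` F.
  move=> x [/phase_spaceE /= ux [k [e|e]]].
    have e1 : iter k T 0 = x by rewrite -(fst_iter k (0, 0)) e.
    exists (k %% m)%N; first by rewrite /= ltn_mod.
    by rewrite -e1 {2}(divn_eq k m) addnC iterD mult.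
  have e1 : iter k T x = 0 by rewrite -(fst_iter k (x, 0)) e.
  exists ((k * m - k) %% m)%N; first by rewrite /= ltn_mod.
  have e2 : iter (k * m - k) T 0 = x.
    by rewrite -e1 -iterD subnK ?mult // leq_pmulr.
  by rewrite -[RHS]e2 {2}(divn_eq (k * m - k) m) addnC iterD mult.
have UF : U01 R `<=` F.
  move=> x hx; have p0 : @phase_space R N (0, 0) by exact/phase_spaceE.
  have : closure F x by apply: (closureS sub); exact: hmin p0 0 x hx.
  rewrite -(closure_id F).1 //; apply: accessible_finite_set_closed.1 finF.
  exact/hausdorff_accessible/norm_hausdorff.
have F0 : leb F = 0%E by exact: countable_lebesgue_measure0 (finite_set_countable finF).
have mF : measurable F by exact: countable_measurable (finite_set_countable finF).
have : (leb (U01 R) <= leb F)%E.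
  by apply: le_measure; rewrite ?inE //; exact: measurable_itv.
by rewrite F0 /leb lebesgue_measure_itv /= lte_fin ltr01 oppr0 adde0 lee_fin ler10.
Qed.

Theorem theorem21 (R : realType) (N : nat) (r : nat) (lam : 'I_r -> R)
    (pi : 'S_r) (zeta1 : R) (a1 a2 : int)
    (hN : (2 <= N)%N)
    (lam_gt0 : forall i, 0 < lam i)
    (lam_sum : \sum_(i < r) lam i = 1)
    (zeta1_gt0 : 0 < zeta1) (zeta1_lt1 : zeta1 < 1)
    (T_lr : linearly_recurrent lam pi)
    (Tf_min : minimal (skew (iet lam pi) (@two_step R N zeta1 a1 a2))) :
  uniquely_ergodic (skew (iet lam pi) (@two_step R N zeta1 a1 a2)).
Proof.
have HT := iet_cellwise pi lam_gt0 lam_sum.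
have onto := iet_onto pi lam_gt0 lam_sum.
have inj := iet_inj (pi := pi) lam_gt0 lam_sum.
have pres := iet_measure_preserving pi lam_gt0 lam_sum.
have [kappa rec] := linearly_recurrent_codes lam_gt0 lam_sum T_lr.
have aper m m0 := @minimal_aperiodic _ _ _ _ m m0 Tf_min.
have z01 : unit01 zeta1 by rewrite /unit01 zeta1_lt1 ltW.
have [delta delta0 often] := good_times HT onto inj pres rec aper z01.
exact: (skew_uniquely_ergodic HT inj pres delta0 often Tf_min).
Qed.
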